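(* Let $T$ be a triangulation of a closed surface $M$ with vertices $V=\{v_1,\dots,v_N\}$, let $d$ be a PL metric associated to $T$, and let $u(t)$, $t\in[0,L_0)$, $0<L_0\le\infty$, be the maximal solution of the normalized combinatorial Yamabe flow $$\frac{du_i}{dt}=-u_i(K_i-K_{av}),\qquad u_i(0)=1,\qquad i=1,\dots,N.$$ If no singularity develops, i.e. $u(t)$ develops neither an essential singularity nor a removable singularity at any time $L\in(0,L_0]$, then the solution exists for all time ($L_0=\infty$) and converges exponentially fast to a constant curvature PL metric as $t\to\infty$; that is, there are $\bar u\in\mathbb{R}^N_{>0}$ such that $\bar u*d$ is a PL metric with the same curvature at all vertices, and constants $c_1,c_2>0$ such that $|u_i(t)-\bar u_i|\le c_1e^{-c_2t}$ for all $t\ge 0$ and all $i$.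
   Context: Let $E$ be the set of edges of $T$. A PL metric associated to $T$ is a function $d:E\to\mathbb{R}_{>0}$ such that for every triangle of $T$ the three values of $d$ on its edges satisfy the strict triangle inequalities; each triangle is identified with the Euclidean triangle with these edge lengths. Write $d_{ij}=d(v_iv_j)$. Given $u:V\to\mathbb{R}_{>0}$, $u_i=u(v_i)$, define $(u*d)(v_iv_j)=u_iu_jd_{ij}$; $u$ is a conformal factor for $d$ if $u*d$ is again a PL metric. The curvature of a PL metric at $v_i$ is $2\pi$ minus the sum of the inner angles at $v_i$ of all triangles of $T$ having $v_i$ as a vertex. In the flow, $u(t)$ is a conformal factor for each $t$, $K_i=K_i(t)$ is the curvature at $v_i$ of $u(t)*d$, and $K_{av}=2\pi\chi(M)/N$. For a solution on $[0,L)$, $0<L\le\infty$: it develops an essential singularity at time $L$ if there are an index $i$ and a sequence $t_n\to L$ in $[0,L)$ with $u_i(t_n)\to0$; it develops a removable singularity at time $L$ if there is a sequence $t_n\to L$ in $[0,L)$ such that for all $i$ the values $u_i(t_n)$ remain in a compact subset of $\mathbb{R}_{>0}$ and some triangle of $T$ degenerates into a line segment, i.e. its vertices can be named $v_i,v_j,v_k$ so that $u_id_{ik}u_k+u_kd_{kj}u_j-u_id_{ij}u_j\to0$ along $t=t_n$. *)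

(* Defs.v *)
From HB Require Import structures.
From mathcomp Require Import all_boot all_order all_algebra.
From mathcomp Require Import all_classical all_reals all_analysis.

Set Implicit Arguments.
Unset Strict Implicit.
Unset Printing Implicit Defensive.

Import Order.TTheory GRing.Theory Num.Theory.
Import numFieldNormedType.Exports.

Local Open Scope classical_set_scope.
Local Open Scope ring_scope.

(* A 2-dimensional simplicial complex on the vertices 'I_N is given by the set
   T of its triangles, each triangle being its set of vertices. *)

Definition edges (N : nat) (T : {set {set 'I_N}}) : {set {set 'I_N}} :=
  [set e : {set 'I_N} | (#|e| == 2%N) && [exists f in T, e \subset f]]%SET.

(* The triangles at v are the v c_m c_(m+1), where c is a simple closed polygon
   (next c is the cyclic successor); this also forces v to belong to T. *)
Definition link_is_cycle (N : nat) (T : {set {set 'I_N}}) (v : 'I_N) : Prop :=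
  exists c : seq 'I_N,
    [/\ uniq c, (3 <= size c)%N, v \notin c
      & [set f in T | v \in f]%SET = [set [set v; w; next c w] | w in c]%SET].

(* The realization of T is a closed surface (connected, without boundary, not
   necessarily orientable) with vertex set exactly 'I_N. *)
Definition closed_surface_triangulation (N : nat) (T : {set {set 'I_N}}) : Prop :=
  [/\ (0 < N)%N,
      forall f, f \in T -> #|f| = 3%N,
      forall v, link_is_cycle T v
    & forall v w, connect [rel x y | [set x; y]%SET \in edges T] v w].

Definition euler_char (N : nat) (T : {set {set 'I_N}}) : int :=
  N%:Z - #|edges T|%:Z + #|T|%:Z.

(* A function on edges is represented by a function on all sets of vertices,
   of which only the values on edges T are ever constrained or used. *)
Definition PL_metric (R : realType) (N : nat) (T : {set {set 'I_N}})
    (d : {set 'I_N} -> R) : Prop :=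
  (forall e, e \in edges T -> 0 < d e) /\
  (forall i j k, [set i; j; k]%SET \in T ->
     d [set i; j]%SET < d [set i; k]%SET + d [set k; j]%SET).

(* For an edge e = {i, j} the value is u_i * u_j * d_ij. *)
Definition conformal_mul (R : realType) (N : nat) (u : 'I_N -> R)
    (d : {set 'I_N} -> R) : {set 'I_N} -> R :=
  fun e => (\prod_(i in e) u i) * d e.

Definition conformal_factor (R : realType) (N : nat) (T : {set {set 'I_N}})
    (d : {set 'I_N} -> R) (u : 'I_N -> R) : Prop :=
  (forall i, 0 < u i) /\ PL_metric T (conformal_mul u d).

(* Angle at i of the Euclidean triangle i j k, by the law of cosines. *)
Definition inner_angle (R : realType) (N : nat) (d : {set 'I_N} -> R)
    (i j k : 'I_N) : R :=
  let a := d [set j; k]%SET in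
  let b := d [set i; k]%SET in
  let c := d [set i; j]%SET in
  acos ((b ^+ 2 + c ^+ 2 - a ^+ 2) / (2 * b * c)).

(* The condition j < k makes every triangle {i, j, k} at i occur once. *)
Definition curvature (R : realType) (N : nat) (T : {set {set 'I_N}})
    (d : {set 'I_N} -> R) (i : 'I_N) : R :=
  2 * pi - \sum_(j < N) \sum_(k < N | (j < k)%N && ([set i; j; k]%SET \in T))
             inner_angle d i j k.

Definition average_curvature (R : realType) (N : nat) (T : {set {set 'I_N}}) : R :=
  2 * pi * (euler_char T)%:~R / N%:R.

Definition time_interval (R : realType) (L : \bar R) : set R :=
  [set t | 0 <= t /\ (t%:E < L)%E].

(* Derivative relative to D: two-sided at interior points of D, and one-sided
   at the left endpoint of a time interval. *)
Definition has_derivative_within (R : realType) (D : set R) (f : R -> R)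
    (t l : R) : Prop :=
  (f s - f t) / (s - t) @[s --> within D t^'] --> l.

Definition yamabe_solution (R : realType) (N : nat) (T : {set {set 'I_N}})
    (d : {set 'I_N} -> R) (L : \bar R) (u : R -> 'I_N -> R) : Prop :=
  [/\ (0 < L)%E,
      forall t, time_interval L t -> conformal_factor T d (u t),
      forall i, u 0 i = 1
    & forall t i, time_interval L t ->
        has_derivative_within (time_interval L) (u ^~ i) t
          (- u t i * (curvature T (conformal_mul (u t) d) i
                      - average_curvature R T))].

Definition maximal_yamabe_solution (R : realType) (N : nat)
    (T : {set {set 'I_N}}) (d : {set 'I_N} -> R) (L : \bar R)
    (u : R -> 'I_N -> R) : Prop :=
  yamabe_solution T d L u /\
  (forall (L' : \bar R) (v : R -> 'I_N -> R),
     (L <= L')%E -> yamabe_solution T d L' v ->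
     (forall t i, time_interval L t -> v t i = u t i) -> L' = L).

Definition essential_singularity (R : realType) (N : nat)
    (u : R -> 'I_N -> R) (L : \bar R) : Prop :=
  exists (i : 'I_N) (t : nat -> R),
    [/\ forall n, time_interval L (t n),
        (t n)%:E @[n --> \oo] --> L
      & u (t n) i @[n --> \oo] --> (0 : R)].

Definition removable_singularity (R : realType) (N : nat)
    (T : {set {set 'I_N}}) (d : {set 'I_N} -> R) (u : R -> 'I_N -> R)
    (L : \bar R) : Prop :=
  exists t : nat -> R,
    [/\ forall n, time_interval L (t n),
        (t n)%:E @[n --> \oo] --> L,
        forall i, exists K : set R,
          [/\ compact K, K `<=` [set x | 0 < x] & forall n, K (u (t n) i)]
      & exists i j k : 'I_N, [set i; j; k]%SET \in T /\
          u (t n) i * d [set i; k]%SET * u (t n) k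
          + u (t n) k * d [set k; j]%SET * u (t n) j
          - u (t n) i * d [set i; j]%SET * u (t n) j @[n --> \oo] --> (0 : R)].

(* Main.v *)
Require Import Defs.
From mathcomp Require Import all_boot all_order all_algebra.
From mathcomp Require Import ring lra.
From mathcomp Require Import all_classical all_reals all_analysis.

(** Write w_i = ln u_i and kappa_i = K_i - K_av, so that the flow reads
    w' = - kappa.  Three facts drive the proof.

    Gauss-Bonnet.  The angles of a Euclidean triangle add up to pi
    ([angle_sum]) and the links being cycles forces 2 |E| = 3 |F|
    ([edges_triangles]); hence sum_i kappa_i = 0 ([sum_curvature_excess]) and
    sum_i w_i is a constant of the motion ([sum_ln_constant]).  Without an
    essential singularity every u_i stays above some c > 0, so the constancy
    of sum_i w_i also bounds every u_i from above; without a removable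
    singularity the triangle inequalities then hold with a uniform margin
    delta > 0 ([bounded_of_no_singularity]).  The solution thus ends up in a
    compact set of conformal factors.

    Completeness.  If the existence time r were finite, the bounded speed would
    make u(t) converge as t tends to r, to a point that is again a conformal
    factor.  The vector field is Lipschitz near that point, so Picard iteration
    ([picard]) restarts the flow there, and the two pieces match in a
    differentiable way because the derivative has a limit at r
    ([is_derive_of_punctured], [flow_extends]).  This contradicts maximality.

    Convexity.  Varying w changes the angle at i of a triangle i j k by
      theta_i' = cot theta_k (w_j' - w_i') + cot theta_j (w_k' - w_i'),
    so the curvature map has a symmetric Jacobian whose quadratic form on each
    triangle is the Dirichlet energy of a linear function.  On the compact set
    above it is bounded below by a multiple of the squared differences of w'
    along edges ([angle_energy]), and, the surface being connected, by a
    multiple of sum_i w_i'^2 on vectors of zero sum ([poincare]).  Therefore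
      d/dt sum_i kappa_i^2 <= - 2 lambda sum_i kappa_i^2
    ([curvature_energy], [excess_sq_decay]): kappa decays exponentially, hence
    so does the speed of u, which makes u converge exponentially to a conformal
    factor with kappa = 0 ([flow_converges]). *)

Import Order.TTheory GRing.Theory Num.Theory.
Import numFieldNormedType.Exports.

Local Open Scope classical_set_scope.
Local Open Scope ring_scope.

Set Implicit Arguments.
Unset Strict Implicit.
Unset Printing Implicit Defensive.

(** * Calculus of one real variable *)

Section RealAnalysis.
Variable R : realType.
Implicit Types f g df : R -> R.

Lemma increment_bound f df (a b M : R) : a <= b ->
  (forall x, a <= x <= b -> is_derive x 1 f (df x)) ->
  (forall x, a <= x <= b -> `|df x| <= M) ->
  `|f b - f a| <= M * (b - a).
Proof.
move=> ab fd dfM.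
have [||c] := @MVT_segment R f df a b ab.
- by move=> x; rewrite in_itv/= => /andP[/ltW ax /ltW xb]; apply: fd; rewrite ax.
- apply: derivable_within_continuous => x; rewrite in_itv/= => xab.
  by have := fd x xab; case.
rewrite in_itv/= => cab ->.
by rewrite normrM (ger0_norm (x := b - a)) ?subr_ge0// ler_wpM2r ?subr_ge0// dfM.
Qed.

Lemma derive_le0_nonincr f df (a b : R) : a <= b ->
  (forall x, a <= x <= b -> is_derive x 1 f (df x)) ->
  (forall x, a <= x <= b -> df x <= 0) -> f b <= f a.
Proof.
move=> ab fd df0.
have [||c] := @MVT_segment R f df a b ab.
- by move=> x; rewrite in_itv/= => /andP[/ltW ax /ltW xb]; apply: fd; rewrite ax.
- apply: derivable_within_continuous => x; rewrite in_itv/= => xab.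
  by have := fd x xab; case.
rewrite in_itv/= => cab E; rewrite -subr_le0 E mulr_le0_ge0 ?subr_ge0//.
exact: df0.
Qed.

Lemma is_derive_continuous f (x l : R) : is_derive x 1 f l -> {for x, continuous f}.
Proof.
by case=> fd _; apply: differentiable_continuous; apply/derivable1_diffP.
Qed.

(** The base point -1 makes 0 interior to the interval on which the primitive
    is differentiable, so that derivatives at time 0 are two-sided. *)
Definition primitive (g : R -> R) (t : R) : R :=
  Rintegral (@lebesgue_measure R) `[-1, t] g
  - Rintegral (@lebesgue_measure R) `[-1, 0] g.

Lemma primitive0 g : primitive g 0 = 0.
Proof. by rewrite /primitive subrr. Qed.

Lemma is_derive_primitive g (t : R) : continuous g -> -1 < t ->
  is_derive t 1 (primitive g) (g t).
Proof.
move=> cg t1.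
have [||||dF F'] := @continuous_FTC1_closed R g (-1) t (t + 1); rewrite ?ltrDl//.
- apply: continuous_compact_integrable; first exact: segment_compact.
  exact: continuous_subspaceT.
- exact: cg.
rewrite /primitive -[g t]subr0; apply: is_deriveB.
by rewrite -F' derive1E; exact: derivableP.
Qed.

(** The intermediate point avoids [r], the one point where the derivative is
    still to be found in [is_derive_of_punctured]. *)
Lemma mean_value_between f df (r z e : R) : z != r -> `|z - r| < e ->
  {for r, continuous f} ->
  (forall s, s != r -> `|s - r| < e -> is_derive s 1 f (df s)) ->
  exists c, [/\ c != r, `|c - r| <= `|z - r| & f z - f r = df c * (z - r)].
Proof.
move=> zr ze fr fd.
have cf s : `|s - r| < e -> {for s, continuous f}.
  move=> se; case: (eqVneq s r) => [->//|sr].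
  exact: is_derive_continuous (fd _ sr se).
have sub (a b : R) : (forall x, a <= x <= b -> `|x - r| < e) ->
    {within `[a, b], continuous f}.
  move=> H; apply: continuous_in_subspaceT => x.
  by rewrite inE/= in_itv/= => /H; exact: cf.
have [rz|rz] := ltP r z.
  have [||c] := @MVT R f df r z rz.
  - move=> x; rewrite in_itv/= => /andP[rx xz]; apply: fd.
      by rewrite gt_eqF.
    by apply: le_lt_trans ze; rewrite !ger0_norm; lra.
  - by apply: sub => x xz; apply: le_lt_trans ze; rewrite !ger0_norm; lra.
  rewrite in_itv/= => /andP[rc cz] E; exists c; split => //.
    by rewrite gt_eqF.
  by rewrite !ger0_norm; lra.
have {}rz : z < r by rewrite lt_neqAle zr.
have [||c] := @MVT R f df z r rz.
- move=> x; rewrite in_itv/= => /andP[rx xz]; apply: fd.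
    by rewrite lt_eqF.
  by apply: le_lt_trans ze; rewrite !ler0_norm; lra.
- by apply: sub => x xz; apply: le_lt_trans ze; rewrite !ler0_norm; lra.
rewrite in_itv/= => /andP[rc cz] E; exists c; split => //.
- by rewrite lt_eqF.
- by rewrite !ler0_norm; lra.
- by rewrite -opprB E -mulrN opprB.
Qed.

(** A limit of the derivative at [r] is the derivative at [r]: difference
    quotients are values of the derivative at intermediate points.  This is
    what glues two solutions of a differential equation. *)
Lemma is_derive_of_punctured f df (r l e : R) : 0 < e ->
  {for r, continuous f} ->
  (forall s, s != r -> `|s - r| < e -> is_derive s 1 f (df s)) ->
  df s @[s --> r^'] --> l ->
  is_derive r 1 f l.
Proof.
move=> e0 fr fd dfl; apply/is_derive1_caratheodory.
exists (fun z => if z == r then l else (f z - f r) / (z - r)); split.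
- move=> z; case: eqVneq => [->|zr]; first by rewrite !subrr mulr0.
  by rewrite divfK// subr_eq0.
- apply/cvgrPdist_le => /= d d0.
  move/cvgrPdist_le: dfl => /(_ d d0) [e' /= e'0 dfl].
  exists (Num.min e e') => /=; first by rewrite lt_min e0.
  move=> z /=; rewrite distrC lt_min => /andP[ze ze'].
  rewrite eqxx; have [_|zr] := eqVneq z r; first by rewrite subrr normr0 ltW.
  have [c [cr cz ->]] := mean_value_between zr ze fr fd.
  rewrite mulfK ?subr_eq0//; apply: dfl => //=.
  by rewrite distrC (le_lt_trans cz).
- by rewrite eqxx.
Qed.

(** The bands [f t - eps t, f t + eps t] pairwise intersect, so the supremum of
    their lower ends lies in all of them.  This produces limits together with
    their rate of convergence, for sequences and for functions of time. *)
Lemma exists_limit_within (I : Type) (A : set I) (f eps : I -> R) : A !=set0 ->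
  (forall s t, A s -> A t -> f t - eps t <= f s + eps s) ->
  exists m, forall t, A t -> `|f t - m| <= eps t.
Proof.
move=> [a Aa] H; set B := [set f t - eps t | t in A].
have sB : has_sup B.
  split; first by exists (f a - eps a); exists a.
  by exists (f a + eps a) => _ [t At <-]; exact: H.
exists (sup B) => t At; rewrite ler_distl.
have h1 : f t - eps t <= sup B by apply: sup_upper_bound => //; exists t.
have h2 : sup B <= f t + eps t.
  by apply: ge_sup => [|_ [s As <-]]; [case: sB|exact: H].
lra.
Qed.

Lemma is_derive_big (J : Type) (s : seq J) (P : pred J) (f : J -> R -> R)
    (df : J -> R) (t : R) : (forall j, P j -> is_derive t 1 (f j) (df j)) ->
  is_derive t 1 (fun x => \sum_(j <- s | P j) f j x) (\sum_(j <- s | P j) df j).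
Proof.
move=> H; elim: s => [|j s IH].
  rewrite big_nil (_ : (fun x => _) = cst 0); first exact: is_derive_cst.
  by apply/funext => x; rewrite big_nil.
rewrite big_cons; case: ifPn => Pj.
  rewrite (_ : (fun x => _) = (f j + (fun x => \sum_(j <- s | P j) f j x))).
    exact: is_deriveD (H j Pj) IH.
  by apply/funext => x; rewrite big_cons Pj.
rewrite (_ : (fun x => _) = (fun x => \sum_(j <- s | P j) f j x))//.
by apply/funext => x; rewrite big_cons (negbTE Pj).
Qed.

Lemma finite_positive_lower_bound (I : finType) (c : I -> R) : (forall i, 0 < c i) ->
  exists2 m, 0 < m & forall i, m <= c i.
Proof.
move=> c0; have s0 i : 0 <= \sum_(j | j != i) (c j)^-1.
  by apply: sumr_ge0 => j _; rewrite invr_ge0 ltW.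
have S0 : 0 <= \sum_j (c j)^-1 by apply: sumr_ge0 => j _; rewrite invr_ge0 ltW.
(* A positive minorant of all the c j, also for an empty index type. *)
exists (1 + \sum_j (c j)^-1)^-1; first by rewrite invr_gt0; lra.
move=> i; rewrite -[leRHS]invrK lef_pV2 ?posrE ?invr_gt0//; last by lra.
by rewrite (bigD1 i)//=; have := s0 i; lra.
Qed.

Lemma near_lower_bound (X : Type) (F : set_system X) (FF : Filter F) (I : finType)
    (f : I -> X -> R) :
  (forall i, exists2 c, 0 < c & \forall t \near F, c <= f i t) ->
  exists2 c, 0 < c & \forall t \near F, forall i, c <= f i t.
Proof.
move=> H; have [c Hc] : exists c : I -> R, forall i, 0 < c i /\ \forall t \near F, c i <= f i t.
  by exists (fun i => s2val (cid2 (H i))) => i; case: cid2.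
have [m m0 mc] := finite_positive_lower_bound (fun i => (Hc i).1).
exists m => //; apply: filter_forall => i; apply: filterS (Hc i).2 => t.
exact: le_trans (mc i).
Qed.

End RealAnalysis.

(** * Picard iteration *)

Section Approximation.
Variable R : realType.

Lemma le_of_geometric (a b C : R) : 0 <= C ->
  (forall n, a <= b + C / 2 ^+ n) -> a <= b.
Proof.
move=> C0 H; apply/ler_addgt0Pr => e e0.
have Ce : 0 <= C / e by rewrite divr_ge0// ltW.
set n := Num.bound (C / e).
have Hn : C / 2 ^+ n <= e.
  rewrite ler_pdivrMr ?exprn_gt0// mulrC -ler_pdivrMr//.
  apply: le_trans (ltW (archi_boundP Ce)) _.
  by rewrite -natrX ler_nat ltnW// ltn_expl.
by have := H n; lra.
Qed.

(** [a n + C / 2 ^+ n] decreases and [a n - C / 2 ^+ n] increases. *)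
Lemma geometric_limit (a : nat -> R) (C : R) :
  (forall n, `|a n.+1 - a n| <= C / 2 ^+ n / 2) ->
  exists m, forall n, `|a n - m| <= C / 2 ^+ n.
Proof.
move=> H.
have step n : C / 2 ^+ n.+1 = C / 2 ^+ n / 2 by rewrite exprSr invfM mulrA.
have up : forall m n, a (m + n)%N + C / 2 ^+ (m + n) <= a n + C / 2 ^+ n.
  elim=> [|m IH] n; first by rewrite add0n.
  apply: le_trans (IH n); rewrite addSn step.
  by move: (H (m + n)%N); rewrite ler_norml => /andP[]; lra.
have dn : forall m n, a n - C / 2 ^+ n <= a (m + n)%N - C / 2 ^+ (m + n).
  elim=> [|m IH] n; first by rewrite add0n.
  apply: le_trans (IH n) _; rewrite addSn step.
  by move: (H (m + n)%N); rewrite ler_norml => /andP[]; lra.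
have pos n : 0 <= C / 2 ^+ n by have := le_trans (normr_ge0 _) (H n); lra.
suff cross s t : [set: nat] s -> [set: nat] t ->
    a t - C / 2 ^+ t <= a s + C / 2 ^+ s.
  have [m Hm] := exists_limit_within (f := a) (eps := fun n => C / 2 ^+ n) (ex_intro _ 0%N I) cross.
  by exists m => n; exact: Hm.
move=> _ _; have [st|/ltnW ts] := leqP t s.
  have := dn (s - t)%N t; rewrite subnK//.
  by have := pos s; lra.
have := up (t - s)%N s; rewrite subnK//.
by have := pos t; lra.
Qed.

Definition clamp (a b t : R) : R := Num.max a (Num.min b t).

Lemma clamp_itv (a b t : R) : a <= b -> a <= clamp a b t <= b.
Proof.
by move=> ab; rewrite /clamp le_max lexx/= ge_max ab ge_min lexx.
Qed.

Lemma clamp_id (a b t : R) : a <= t <= b -> clamp a b t = t.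
Proof. by move=> /andP[at_ tb]; rewrite /clamp (min_idPr tb); exact/max_idPr. Qed.

Lemma clamp_lip (a b s t : R) : `|clamp a b s - clamp a b t| <= `|s - t|.
Proof.
wlog ts : s t / t <= s => [H|].
  by case/orP: (le_total t s) => ?; [|rewrite distrC (distrC s)]; exact: H.
rewrite (ger0_norm (x := s - t)) ?subr_ge0// ler_norml /clamp !maxEle !minEle.
by case: (leP b s) => ?; case: (leP b t) => ? /=; case: (leP a b) => ?;
  case: (leP a s) => ?; case: (leP a t) => ? /=; lra.
Qed.

Lemma lipschitz_continuous (g : R -> R) (M : R) :
  (forall s t, `|g s - g t| <= M * `|s - t|) -> continuous g.
Proof.
move=> H t; have M0 : 0 <= M.
  by have := le_trans (normr_ge0 _) (H 1 0); rewrite subr0 normr1 mulr1.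
apply/cvgrPdist_le => /= e e0.
have M1 : 0 < M + 1 by lra.
exists (e / (M + 1)) => /=; first by rewrite divr_gt0.
move=> s /= ts; apply: le_trans (H _ _) _.
rewrite ltr_pdivlMr// in ts.
have := normr_ge0 (t - s); nra.
Qed.

End Approximation.

Section Picard.
Variables (R : realType) (N : nat).
Variables (F : ('I_N -> R) -> 'I_N -> R) (L M : R).
Hypotheses (L0 : 0 < L) (M0 : 0 <= M).
Hypothesis FM : forall x i, `|F x i| <= M.
Hypothesis FL : forall x y e, (forall i, `|x i - y i| <= e) ->
  forall i, `|F x i - F y i| <= L * e.
Variable x0 : 'I_N -> R.

Let h := (2 * L)^-1.
Let h0 : 0 < h. Proof. by rewrite invr_gt0 mulr_gt0. Qed.

(** The time is clamped to [0, h] so that the iterates are defined, and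
    Lipschitz, on the whole line. *)
Definition picard_step (x : R -> 'I_N -> R) (t : R) (i : 'I_N) : R :=
  x0 i + primitive (fun s => F (x s) i) (clamp 0 h t).

Let lip (x : R -> 'I_N -> R) := forall s t i, `|x s i - x t i| <= M * `|s - t|.

Let F_continuous x i : lip x -> continuous (fun s => F (x s) i).
Proof.
move=> lx; apply: (@lipschitz_continuous _ _ (L * M)) => s t.
by rewrite -mulrA; apply: FL => j; exact: lx.
Qed.

Let clamp_bounds t : 0 <= clamp 0 h t <= h.
Proof. by apply: clamp_itv; exact: ltW. Qed.

Let primitive_lip x i (s t : R) : lip x -> 0 <= s -> 0 <= t ->
  `|primitive (fun r => F (x r) i) s - primitive (fun r => F (x r) i) t|
  <= M * `|s - t|.
Proof.
move=> lx; wlog ts : s t / t <= s => [H|] s0 t0.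
  by case/orP: (le_total t s) => ?; [|rewrite distrC (distrC s)]; exact: H.
rewrite (ger0_norm (x := s - t)) ?subr_ge0//.
apply: (increment_bound (df := fun r => F (x r) i)) => // r /andP[tr _].
apply: is_derive_primitive; [exact: F_continuous|lra].
Qed.

Let step_lip x : lip x -> lip (picard_step x).
Proof.
move=> lx s t i; rewrite /picard_step opprD addrACA subrr add0r.
have /andP[? _] := clamp_bounds s; have /andP[? _] := clamp_bounds t.
by apply: le_trans (primitive_lip _ _ _ _) _ => //; rewrite ler_wpM2l// clamp_lip.
Qed.

Let step_contract x y e : lip x -> lip y ->
  (forall t i, `|x t i - y t i| <= e) ->
  forall t i, `|picard_step x t i - picard_step y t i| <= e / 2.
Proof.
move=> lx ly xy t i; rewrite /picard_step opprD addrACA subrr add0r.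
have /andP[c0 ch] := clamp_bounds t.
have e0 : 0 <= e := le_trans (normr_ge0 _) (xy 0 i).
set c := clamp 0 h t.
pose f r := primitive (fun r => F (x r) i) r - primitive (fun r => F (y r) i) r.
have -> : e / 2 = L * e * h by rewrite /h invfM; field; rewrite gt_eqF.
have fc : `|f c - f 0| <= L * e * (c - 0).
  apply: (increment_bound (df := fun r => F (x r) i - F (y r) i)) => // r.
    move=> /andP[r0 _]; apply: is_deriveB; apply: is_derive_primitive;
    by [exact: F_continuous|lra].
  by move=> _; apply: FL => j; exact: xy.
move: fc; rewrite /f !primitive0 !subr0 => /le_trans; apply.
by rewrite ler_wpM2l// mulr_ge0// ltW.
Qed.

(** With h = 1 / (2 L) the integral operator halves uniform distances, and
    the iterates converge geometrically to a fixed point.  Derivatives are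
    two-sided, also at time 0. *)
Theorem picard : exists h : R, 0 < h /\ exists w : R -> 'I_N -> R,
  [/\ w 0 = x0,
      forall t i, 0 <= t < h -> is_derive t 1 (w ^~ i) (F (w t) i)
    & forall t i, 0 <= t < h -> `|w t i - x0 i| <= M * t].
Proof.
exists h; split => //.
pose xs n := iter n picard_step (fun=> x0).
have xs_lip n : lip (xs n).
  elim: n => [s t i|n IH]; first by rewrite subrr normr0 mulr_ge0.
  exact: step_lip.
have xs_diff n t i : `|xs n.+1 t i - xs n t i| <= 2 * M * h / 2 ^+ n / 2.
  elim: n t i => [|n IH] t i.
    rewrite expr0 invr1 mulr1 /= /picard_step addrC addKr.
    have /andP[c0 ch] := clamp_bounds t.
    have := primitive_lip i (xs_lip 0%N) c0 (lexx 0).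
    rewrite primitive0 !subr0 (ger0_norm c0) => /le_trans; apply.
    by have := ler_wpM2l M0 ch; lra.
  rewrite exprSr invfM mulrA; apply: step_contract; first exact: (xs_lip n.+1).
    exact: xs_lip.
  exact: IH.
have [x xsx] : exists x, forall t i n, `|xs n t i - x t i| <= 2 * M * h / 2 ^+ n.
  have H t i := geometric_limit (fun n => xs_diff n t i).
  by exists (fun t => projT1 (choice (H t))) => t; exact: projT2 (choice (H t)).
have C0 : 0 <= 2 * M * h by rewrite !mulr_ge0// ltW.
have x_lip : lip x.
  move=> s t i; apply: (@le_of_geometric _ _ _ (2 * (2 * M * h))).
    by rewrite mulr_ge0.
  move=> n; have := xsx s i n; have := xsx t i n; have := xs_lip n s t i.
  rewrite !ler_norml => /andP[? ?] /andP[? ?] /andP[? ?]; lra.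
have fixed t i : picard_step x t i = x t i.
  apply/eqP; rewrite -subr_eq0 -normr_le0.
  apply: (@le_of_geometric _ _ _ (2 * M * h)) => // n.
  have xsx' s j : `|x s j - xs n s j| <= 2 * M * h / 2 ^+ n by rewrite distrC.
  have := step_contract x_lip (xs_lip n) xsx' t i.
  have := xsx t i n.+1; rewrite exprSr invfM mulrA.
  rewrite /= !ler_norml => /andP[? ?] /andP[? ?]; lra.
pose w t i := x0 i + primitive (fun s => F (x s) i) t.
have wx t : 0 <= t <= h -> w t = x t.
  move=> th; apply/funext => i.
  by rewrite -fixed /picard_step clamp_id.
exists w; split.
- by apply/funext => i; rewrite /w primitive0 addr0.
- move=> t i /andP[t0 th]; rewrite wx ?t0 ?ltW// /w -[F (x t) i]add0r.
  apply: is_deriveD; apply: is_derive_primitive; [exact: F_continuous|lra].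
- move=> t i /andP[t0 th]; rewrite /w addrC addKr.
  by have := primitive_lip i x_lip t0 (lexx 0); rewrite primitive0 !subr0 (ger0_norm t0).
Qed.
End Picard.

(** * Euclidean triangles *)

Section EuclideanTriangle.
Variable R : realType.
Implicit Types a b c : R.

Definition law_cos a b c : R := (b ^+ 2 + c ^+ 2 - a ^+ 2) / (2 * b * c).

(** Sixteen times the squared area of the triangle. *)
Definition heron a b c : R := (a + b + c) * (a + b - c) * (b + c - a) * (a + c - b).

Definition triangle_ineqs a b c : Prop := [/\ a < b + c, b < a + c & c < a + b].

Lemma triangle_rot a b c : triangle_ineqs a b c -> triangle_ineqs b c a.
Proof. by case=> *; split; lra. Qed.

Lemma triangle_pos a b c : triangle_ineqs a b c -> [/\ 0 < a, 0 < b & 0 < c].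
Proof. by case=> *; split; lra. Qed.

Lemma heron_rot a b c : heron b c a = heron a b c.
Proof. by rewrite /heron; ring. Qed.

Lemma heron_gt0 a b c : triangle_ineqs a b c -> 0 < heron a b c.
Proof.
move=> t; have [a0 b0 c0] := triangle_pos t; case: t => *.
by rewrite /heron !mulr_gt0//; lra.
Qed.

Lemma law_cos_itv a b c : triangle_ineqs a b c -> -1 < law_cos a b c < 1.
Proof.
move=> t; have [a0 b0 c0] := triangle_pos t; case: t => ? ? ?.
have bc : 0 < 2 * b * c by rewrite !mulr_gt0.
by rewrite /law_cos ltr_pdivlMr// ltr_pdivrMr//; apply/andP; split; nra.
Qed.

(** Heron's formula: the sine of the angle between sides [b] and [c] is twice
    the area divided by [b * c]. *)
Lemma sin_law_cos a b c : triangle_ineqs a b c ->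
  Num.sqrt (1 - law_cos a b c ^+ 2) = Num.sqrt (heron a b c) / (2 * b * c).
Proof.
move=> t; have [a0 b0 c0] := triangle_pos t.
have bc : 0 < 2 * b * c by rewrite !mulr_gt0.
rewrite -[X in _ / X]ger0_norm ?ltW// -sqrtr_sqr -sqrtrV ?sqr_ge0//.
rewrite -sqrtrM ?ltW ?heron_gt0//; congr Num.sqrt; rewrite /law_cos /heron.
by field; rewrite !gt_eqF.
Qed.

(** The addition formulas give to the sum of two angles the cosine and the sine
    of the supplement of the third; the sign of the sine places that sum in
    [0, pi], where the cosine is injective. *)
Lemma angle_sum a b c : triangle_ineqs a b c ->
  acos (law_cos a b c) + acos (law_cos b c a) + acos (law_cos c a b) = pi.
Proof.
move=> t; have [a0 b0 c0] := triangle_pos t.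
have t' := triangle_rot t; have t'' := triangle_rot t'.
set x := law_cos a b c; set y := law_cos b c a; set z := law_cos c a b.
have /andP[x1 x2] : -1 < x < 1 := law_cos_itv t.
have /andP[y1 y2] : -1 < y < 1 := law_cos_itv t'.
have /andP[z1 z2] : -1 < z < 1 := law_cos_itv t''.
have X : -1 <= x <= 1 by rewrite !ltW.
have Y : -1 <= y <= 1 by rewrite !ltW.
have Z : -1 <= z <= 1 by rewrite !ltW.
have px := acos_gt0 (x := x); have py := acos_gt0 (x := y); have pz := acos_gt0 (x := z).
rewrite ltW// in px; rewrite ltW// in py; rewrite ltW// in pz.
have {}px := px x2; have {}py := py y2; have {}pz := pz z2.
have qx := acos_ltpi (x := x); have qy := acos_ltpi (x := y); have qz := acos_ltpi (x := z).
rewrite x1 ltW// in qx; rewrite y1 ltW// in qy; rewrite z1 ltW// in qz.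
have {}qx := qx isT; have {}qy := qy isT; have {}qz := qz isT.
have S0 : 0 < Num.sqrt (heron a b c) by rewrite sqrtr_gt0 heron_gt0.
have S2 : Num.sqrt (heron a b c) ^+ 2 = heron a b c by rewrite sqr_sqrtr// ltW ?heron_gt0.
have sx : sin (acos x) = Num.sqrt (heron a b c) / (2 * b * c).
  by rewrite sin_acos// sin_law_cos.
have sy : sin (acos y) = Num.sqrt (heron a b c) / (2 * c * a).
  by rewrite sin_acos// sin_law_cos// heron_rot.
have cosK' (w : R) : -1 <= w <= 1 -> cos (acos w) = w.
  by move=> w1; rewrite acosK// in_itv.
have cxy : cos (acos x + acos y) = - z.
  rewrite cosD !cosK'// sx sy.
  have -> : Num.sqrt (heron a b c) / (2 * b * c) * (Num.sqrt (heron a b c) / (2 * c * a))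
      = heron a b c / (2 * b * c) / (2 * c * a).
    by rewrite -[in RHS]S2; field; rewrite !gt_eqF.
  rewrite /x /y /z /law_cos /heron.
  by field; rewrite !gt_eqF.
have sxy : 0 < sin (acos x + acos y).
  rewrite sinD !cosK'// sx sy.
  rewrite (_ : _ + _ = Num.sqrt (heron a b c) / (2 * a * b)).
    by rewrite divr_gt0// !mulr_gt0.
  rewrite /x /y /law_cos.
  by field; rewrite !gt_eqF.
have xy_pi : acos x + acos y <= pi.
  rewrite leNgt; apply/negP => xypi.
  have : 0 < sin (acos x + acos y - pi) by apply: sin_gt0_pi; lra.
  have -> : sin (acos x + acos y - pi) = - sin (acos x + acos y).
    by rewrite sinB cospi sinpi mulr0 subr0 mulrN1.
  by lra.
have E : acos x + acos y = pi - acos z.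
  apply: cos_inj; rewrite ?in_itv/=.
  - by lra.
  - by lra.
  - by rewrite cxy cosB cospi sinpi mul0r addr0 mulN1r cosK'.
by rewrite E subrK.
Qed.

(** The sides vary with logarithmic rates [wj + wk], [wi + wk], [wi + wj], as
    they do under a conformal change with logarithmic rates [w].  Since
    cot theta_k = (a^2 + b^2 - c^2) / (4 area) and [Num.sqrt (heron a b c)] is
    four times the area, the result is
    cot theta_k (wj - wi) + cot theta_j (wk - wi). *)
Lemma is_derive_angle (fa fb fc : R -> R) (t wi wj wk : R) :
  triangle_ineqs (fa t) (fb t) (fc t) ->
  is_derive t 1 fa (fa t * (wj + wk)) ->
  is_derive t 1 fb (fb t * (wi + wk)) ->
  is_derive t 1 fc (fc t * (wi + wj)) ->
  is_derive t 1 (fun s => acos (law_cos (fa s) (fb s) (fc s)))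
    ((Num.sqrt (heron (fa t) (fb t) (fc t)))^-1 *
     ((fa t ^+ 2 + fb t ^+ 2 - fc t ^+ 2) * (wj - wi) +
      (fa t ^+ 2 + fc t ^+ 2 - fb t ^+ 2) * (wk - wi))).
Proof.
move=> tri Da Db Dc; have [a0 b0 c0] := triangle_pos tri.
have S0 : 0 < Num.sqrt (heron (fa t) (fb t) (fc t)) by rewrite sqrtr_gt0 heron_gt0.
have bc : 2 * fb t * fc t != 0 by rewrite gt_eqF// !mulr_gt0.
have Dden : is_derive t 1 (fun s => 2 * fb s * fc s)
    (2 * fb t * (fc t * (wi + wj)) + fc t * (2 * (fb t * (wi + wk)))).
  apply: (is_derive_eq (is_deriveM (is_deriveM (is_derive_cst (2 : R) t 1) Db) Dc)).
  by rewrite /= /GRing.scale/= mulr0 addr0.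
have Dnum : is_derive t 1 (fun s => fb s ^+ 2 + fc s ^+ 2 - fa s ^+ 2)
    (2 * fb t * (fb t * (wi + wk)) + 2 * fc t * (fc t * (wi + wj))
     - 2 * fa t * (fa t * (wj + wk))).
  apply: (is_derive_eq
    (is_deriveB (is_deriveD (is_deriveX 2 Db) (is_deriveX 2 Dc)) (is_deriveX 2 Da))).
  by rewrite /= /GRing.scale/= !expr1.
have Dlc := is_deriveM Dnum (@is_deriveV R (fun s => 2 * fb s * fc s) t _ 1 bc Dden).
have Dacos := is_derive1_acos (law_cos_itv tri).
apply: (is_derive_eq (@is_derive1_comp R acos _ t _ _ Dacos Dlc)).
rewrite sin_law_cos// /GRing.scale/=.
by field; rewrite ?gt_eqF.
Qed.

(** In the variables p = wj - wi and q = wk - wi the left-hand side is minus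
    the quadratic form with matrix
    M = ((2 b^2, - m), (- m, 2 c^2)) / Num.sqrt (heron a b c), where
    m = b^2 + c^2 - a^2.  The determinant of the numerator is [heron a b c],
    and Cayley-Hamilton, M^2 = tr(M) M - det(M), bounds the form from below by
    det(M) / tr(M) times p^2 + q^2. *)
Lemma angle_energy a b c (wi wj wk delta B : R) : 0 < delta ->
  delta <= a + b - c -> delta <= b + c - a -> delta <= a + c - b ->
  b <= B -> c <= B ->
  wi * ((Num.sqrt (heron a b c))^-1 *
     ((a ^+ 2 + b ^+ 2 - c ^+ 2) * (wj - wi) + (a ^+ 2 + c ^+ 2 - b ^+ 2) * (wk - wi)))
  + wj * ((Num.sqrt (heron b c a))^-1 *
     ((b ^+ 2 + c ^+ 2 - a ^+ 2) * (wk - wj) + (b ^+ 2 + a ^+ 2 - c ^+ 2) * (wi - wj)))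
  + wk * ((Num.sqrt (heron c a b))^-1 *
     ((c ^+ 2 + a ^+ 2 - b ^+ 2) * (wi - wk) + (c ^+ 2 + b ^+ 2 - a ^+ 2) * (wj - wk)))
  <= - (delta ^+ 2 / (4 * B ^+ 2) * ((wj - wi) ^+ 2 + (wk - wi) ^+ 2)).
Proof.
move=> d0 h1 h2 h3 bB cB.
have tri : triangle_ineqs a b c by split; lra.
have [a0 b0 c0] := triangle_pos tri.
rewrite (heron_rot b c a) !(heron_rot a b c).
have H0 := heron_gt0 tri.
(* The perimeter is the sum of the three gaps, so all four factors of
   [heron a b c] are at least [delta]. *)
have dS : delta ^+ 2 <= Num.sqrt (heron a b c).
  rewrite -[delta ^+ 2]ger0_norm ?sqr_ge0// -sqrtr_sqr ler_sqrt ?(ltW H0)//.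
  have d1 : 0 <= delta by lra.
  rewrite -exprM (_ : delta ^+ (2 * 2) = delta * delta * delta * delta); last by ring.
  have d2 : delta * delta <= (a + b + c) * (a + b - c) by apply: ler_pM; lra.
  have d3 : delta * delta * delta <= (a + b + c) * (a + b - c) * (b + c - a).
    by apply: ler_pM => //; rewrite mulr_ge0.
  by rewrite /heron; apply: ler_pM => //; rewrite !mulr_ge0.
set S := Num.sqrt _ in dS *.
have S0 : 0 < S by rewrite /S sqrtr_gt0.
have S2 : S ^+ 2 = heron a b c by rewrite /S sqr_sqrtr// ltW.
have B0 : 0 < B by lra.
set p := wj - wi; set q := wk - wi.
have wj_ : wj = wi + p by rewrite /p; ring.
have wk_ : wk = wi + q by rewrite /q; ring.
set form := 2 * b ^+ 2 * p ^+ 2 + 2 * c ^+ 2 * q ^+ 2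
            - 2 * (b ^+ 2 + c ^+ 2 - a ^+ 2) * p * q.
rewrite [leLHS](_ : _ = - (form / S)); last first.
  by rewrite /form wj_ wk_; ring.
rewrite lerN2 ler_pdivlMr//.
(* The difference of the two sides is the squared norm of S * M applied to (p, q). *)
have key : S ^+ 2 * (p ^+ 2 + q ^+ 2) <= 2 * (b ^+ 2 + c ^+ 2) * form.
  set m := b ^+ 2 + c ^+ 2 - a ^+ 2.
  rewrite -subr_ge0 S2 (_ : _ - _ = (2 * b ^+ 2 * p - m * q) ^+ 2
                                + (2 * c ^+ 2 * q - m * p) ^+ 2).
    by rewrite addr_ge0 ?sqr_ge0.
  by rewrite /form /m /heron; ring.
have n0 : 0 <= p ^+ 2 + q ^+ 2 by rewrite addr_ge0 ?sqr_ge0.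
have f0 : 0 <= form.
  rewrite -(pmulr_rge0 (x := 2 * (b ^+ 2 + c ^+ 2))); last first.
    by rewrite mulr_gt0// addr_gt0 ?exprn_gt0.
  by apply: le_trans key; rewrite mulr_ge0 ?sqr_ge0.
have key2 : S ^+ 2 * (p ^+ 2 + q ^+ 2) <= 4 * B ^+ 2 * form.
  by apply: le_trans key _; rewrite ler_wpM2r//; nra.
have B4 : 0 < 4 * B ^+ 2 by rewrite mulr_gt0 ?exprn_gt0.
have le1 : delta ^+ 2 * S * (p ^+ 2 + q ^+ 2) <= S ^+ 2 * (p ^+ 2 + q ^+ 2).
  by rewrite ler_wpM2r// expr2 ler_wpM2r// ltW.
have -> : delta ^+ 2 / (4 * B ^+ 2) * (p ^+ 2 + q ^+ 2) * S
  = delta ^+ 2 * S * (p ^+ 2 + q ^+ 2) / (4 * B ^+ 2).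
  by field; rewrite gt_eqF.
by rewrite ler_pdivrMr// (mulrC form) (le_trans le1).
Qed.
End EuclideanTriangle.

(** * Functions that are Lipschitz near a point *)

Section LocallyLipschitz.
Variables (R : realType) (I : Type).
Implicit Types (x y z : I -> R) (f g : (I -> R) -> R).

(** Lipschitz on a box around [x] for the sup norm, phrased by bounds on the
    coordinates. *)
Definition lipschitz_near x f : Prop := exists r L : R, [/\ 0 < r, 0 <= L &
  forall y z e, (forall i, `|y i - x i| <= r) -> (forall i, `|z i - x i| <= r) ->
    (forall i, `|y i - z i| <= e) -> `|f y - f z| <= L * e].

Lemma lipschitz_near_cst x (a : R) : lipschitz_near x (fun=> a).
Proof.
exists 1, 0; split => // y z e _ _ _.
by rewrite subrr normr0 mul0r.
Qed.

Lemma lipschitz_near_coord x i : lipschitz_near x (fun y => y i).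
Proof. by exists 1, 1; split => // y z e _ _ H; rewrite mul1r. Qed.

Lemma lipschitz_near_ext x f g : f =1 g -> lipschitz_near x f -> lipschitz_near x g.
Proof. by move=> /funext ->. Qed.

Lemma lipschitz_nearD x f g : lipschitz_near x f -> lipschitz_near x g ->
  lipschitz_near x (fun y => f y + g y).
Proof.
move=> [r [L [r0 L0 fL]]] [r' [L' [r'0 L'0 gL]]].
exists (Num.min r r'), (L + L'); split; first by rewrite lt_min r0.
  exact: addr_ge0.
move=> y z e yr zr yz; rewrite opprD addrACA mulrDl.
apply: le_trans (ler_normD _ _) _; apply: lerD; [apply: fL|apply: gL] => // i;
by [have := yr i; rewrite le_min => /andP[]|have := zr i; rewrite le_min => /andP[]].
Qed.

(** A Lipschitz function on a box is bounded there. *)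
Lemma lipschitz_nearM x f g : lipschitz_near x f -> lipschitz_near x g ->
  lipschitz_near x (fun y => f y * g y).
Proof.
move=> [r [L [r0 L0 fL]]] [r' [L' [r'0 L'0 gL]]].
pose A := `|f x| + L * r; pose B := `|g x| + L' * r'.
have A0 : 0 <= A by rewrite addr_ge0// mulr_ge0// ltW.
have B0 : 0 <= B by rewrite addr_ge0// mulr_ge0// ltW.
exists (Num.min r r'), (A * L' + B * L); split; first by rewrite lt_min r0.
  by rewrite addr_ge0// mulr_ge0.
move=> y z e yr zr yz.
have {}yr i : `|y i - x i| <= r /\ `|y i - x i| <= r'.
  by have := yr i; rewrite le_min => /andP[].
have {}zr i : `|z i - x i| <= r /\ `|z i - x i| <= r'.
  by have := zr i; rewrite le_min => /andP[].
have fy : `|f y| <= A.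
  have := fL y x r (fun i => (yr i).1) _ (fun i => (yr i).1).
  move=> /(_ (fun i => _)) H; rewrite /A -lerBlDl; apply: le_trans (lerB_dist _ _) _.
  by apply: H => i; rewrite subrr normr0 ltW.
have gz : `|g z| <= B.
  have := gL z x r' (fun i => (zr i).2) _ (fun i => (zr i).2).
  move=> /(_ (fun i => _)) H; rewrite /B -lerBlDl; apply: le_trans (lerB_dist _ _) _.
  by apply: H => i; rewrite subrr normr0 ltW.
have -> : f y * g y - f z * g z = f y * (g y - g z) + g z * (f y - f z) by ring.
rewrite mulrDl -!mulrA; apply: le_trans (ler_normD _ _) _; rewrite !normrM.
apply: lerD; apply: ler_pM => //.
  by apply: gL => // i; [have [] := yr i|have [] := zr i].
by apply: fL => // i; [have [] := yr i|have [] := zr i].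
Qed.

Lemma lipschitz_nearN x f : lipschitz_near x f -> lipschitz_near x (fun y => - f y).
Proof.
move=> fl; apply: lipschitz_near_ext (lipschitz_nearM (lipschitz_near_cst x (-1)) fl).
by move=> y; rewrite mulN1r.
Qed.

Lemma lipschitz_near_sum x (J : Type) (s : seq J) (P : pred J) (f : J -> (I -> R) -> R) :
  (forall j, P j -> lipschitz_near x (f j)) ->
  lipschitz_near x (fun y => \sum_(j <- s | P j) f j y).
Proof.
move=> H; elim: s => [|j s IH].
  by apply: lipschitz_near_ext (lipschitz_near_cst x 0) => y; rewrite big_nil.
case Pj : (P j).
  apply: lipschitz_near_ext (lipschitz_nearD (H j Pj) IH) => y.
  by rewrite big_cons Pj.
by apply: lipschitz_near_ext IH => y; rewrite big_cons Pj.
Qed.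

Lemma lipschitz_near_prod x (J : Type) (s : seq J) (P : pred J) (f : J -> (I -> R) -> R) :
  (forall j, P j -> lipschitz_near x (f j)) ->
  lipschitz_near x (fun y => \prod_(j <- s | P j) f j y).
Proof.
move=> H; elim: s => [|j s IH].
  by apply: lipschitz_near_ext (lipschitz_near_cst x 1) => y; rewrite big_nil.
case Pj : (P j).
  apply: lipschitz_near_ext (lipschitz_nearM (H j Pj) IH) => y.
  by rewrite big_cons Pj.
by apply: lipschitz_near_ext IH => y; rewrite big_cons Pj.
Qed.

Lemma lipschitz_near_comp x f (phi : R -> R) (r L : R) : 0 < r -> 0 <= L ->
  (forall s t, `|s - f x| <= r -> `|t - f x| <= r -> `|phi s - phi t| <= L * `|s - t|) ->
  lipschitz_near x f -> lipschitz_near x (fun y => phi (f y)).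
Proof.
move=> r0 L0 phiL [r' [L' [r'0 L'0 fL]]].
have L1 : 0 < L' + 1 by lra.
exists (Num.min r' (r / (L' + 1))), (L * L'); split.
- by rewrite lt_min r'0 divr_gt0.
- exact: mulr_ge0.
have fbox y : (forall i, `|y i - x i| <= Num.min r' (r / (L' + 1))) -> `|f y - f x| <= r.
  move=> yr; have {}yr i : `|y i - x i| <= r' /\ `|y i - x i| <= r / (L' + 1).
    by have := yr i; rewrite le_min => /andP[].
  apply: (@le_trans _ _ (L' * (r / (L' + 1)))).
    apply: fL => i; [by case: (yr i)|by rewrite subrr normr0 ltW|by case: (yr i)].
  by rewrite mulrA ler_pdivrMr//; nra.
move=> y z e yr zr yz; apply: le_trans (phiL _ _ (fbox _ yr) (fbox _ zr)) _.
rewrite -mulrA ler_wpM2l//; apply: fL => // i.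
  by have := yr i; rewrite le_min => /andP[].
by have := zr i; rewrite le_min => /andP[].
Qed.

Lemma lipschitz_nearV x f : f x != 0 -> lipschitz_near x f ->
  lipschitz_near x (fun y => (f y)^-1).
Proof.
move=> fx0; have n0 : 0 < `|f x| by rewrite normr_gt0.
apply: (@lipschitz_near_comp _ _ _ (`|f x| / 2) (4 / `|f x| ^+ 2)).
- by rewrite divr_gt0.
- by rewrite divr_ge0// sqr_ge0.
move=> s t sf tf.
have half v : `|v - f x| <= `|f x| / 2 -> `|f x| / 2 <= `|v|.
  rewrite distrC => H; have := le_trans (lerB_dist _ _) H; lra.
have hs := half _ sf; have ht := half _ tf.
have s0 : 0 < `|s| by lra.
have t0 : 0 < `|t| by lra.
have -> : s^-1 - t^-1 = (t - s) / (s * t).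
  by field; rewrite -!normr_gt0 s0 t0.
rewrite normrM normfV normrM distrC mulrC ler_wpM2r//.
rewrite -[X in _ <= X]invrK lef_pV2 ?posrE ?invr_gt0 ?divr_gt0 ?exprn_gt0 ?mulr_gt0//.
rewrite invfM invrK; nra.
Qed.

(** Away from the endpoints -1 and 1 the derivative of [acos] is bounded; the
    midpoint [m] between [`|f x|] and 1 keeps that distance. *)
Lemma lipschitz_near_acos x f : -1 < f x < 1 -> lipschitz_near x f ->
  lipschitz_near x (fun y => acos (f y)).
Proof.
move=> /andP[f1 f2]; set a := `|f x|.
have a1 : a < 1 by rewrite /a ltr_norml f1.
have a0 : 0 <= a by exact: normr_ge0.
set m := (1 + a) / 2.
have m2 : 0 < 1 - m ^+ 2 by rewrite /m; nra.
apply: (@lipschitz_near_comp _ _ _ ((1 - a) / 2) (Num.sqrt (1 - m ^+ 2))^-1).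
- by lra.
- by rewrite invr_ge0 sqrtr_ge0.
have box s : `|s - f x| <= (1 - a) / 2 -> - m <= s <= m.
  move=> H; rewrite -ler_norml /m.
  by have := le_trans (lerB_dist _ _) H; rewrite -/a; lra.
move=> s t; wlog ts : s t / t <= s => [H sf tf|/box/andP[s1 s2] /box/andP[t1 t2]].
  by case/orP: (le_total t s) => ?; [|rewrite distrC (distrC s)]; exact: H.
have itv r : t <= r <= s -> -1 < r < 1.
  by move=> /andP[? ?]; apply/andP; rewrite /m in s1 s2 t1 t2; split; lra.
rewrite (ger0_norm (x := s - t)) ?subr_ge0//.
apply: (increment_bound (df := fun r => - (Num.sqrt (1 - r ^+ 2))^-1)) => // r rst.
  by apply: is_derive1_acos; exact: itv.
have rm : r ^+ 2 <= m ^+ 2.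
  by case/andP: rst => ? ?; rewrite /m in s1 s2 t1 t2 *; nra.
rewrite normrN ger0_norm ?invr_ge0 ?sqrtr_ge0//.
rewrite lef_pV2 ?posrE ?sqrtr_gt0//; last by lra.
by rewrite ler_sqrt; lra.
Qed.

Lemma lipschitz_near_cvg x f (T : Type) (F : set_system T) {FF : Filter F}
    (u : T -> I -> R) : lipschitz_near x f ->
  (forall e, 0 < e -> \forall t \near F, forall i, `|u t i - x i| <= e) ->
  f (u t) @[t --> F] --> f x.
Proof.
move=> [r [L [r0 L0 fL]]] ux; apply/cvgrPdist_le => /= e e0.
have L1 : 0 < L + 1 by lra.
have m0 : 0 < Num.min r (e / (L + 1)) by rewrite lt_min r0 divr_gt0.
have := ux _ m0; apply: filterS => t H.
have {}H i : `|u t i - x i| <= r /\ `|u t i - x i| <= e / (L + 1).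
  by have := H i; rewrite le_min => /andP[].
rewrite distrC; apply: (@le_trans _ _ (L * (e / (L + 1)))).
  by apply: fL => i; [case: (H i)|rewrite subrr normr0 ltW|case: (H i)].
by rewrite mulrA ler_pdivrMr//; nra.
Qed.

Lemma lipschitz_near_gt0 x f : lipschitz_near x f -> 0 < f x ->
  exists2 r, 0 < r & forall y, (forall i, `|y i - x i| <= r) -> 0 < f y.
Proof.
move=> [r [L [r0 L0 fL]]] fx.
have L1 : 0 < L + 1 by lra.
exists (Num.min r (f x / (L + 1))); first by rewrite lt_min r0 divr_gt0.
move=> y H.
have {}H i : `|y i - x i| <= r /\ `|y i - x i| <= f x / (L + 1).
  by have := H i; rewrite le_min => /andP[].
have : `|f y - f x| <= L * (f x / (L + 1)).
  by apply: fL => i; [case: (H i)|rewrite subrr normr0 ltW|case: (H i)].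
have : L * (f x / (L + 1)) < f x by rewrite mulrA ltr_pdivrMr//; nra.
rewrite ler_norml => ? /andP[? ?]; lra.
Qed.
End LocallyLipschitz.

(** * Counting in a triangulated surface *)

Section TripleSums.
Variables (R : realType) (N : nat) (T : {set {set 'I_N}}).
Implicit Types (g : 'I_N -> 'I_N -> 'I_N -> R) (y : 'I_N -> R).
Hypothesis T3 : forall f, f \in T -> #|f| = 3%N.

(** A sum over ordered triples counts each triangle six times, but is invariant
    under relabelling the vertices, which a sum over [j < k] is not. *)
Definition triple_sum g : R :=
  \sum_i \sum_j \sum_(k | [set i; j; k]%SET \in T) g i j k.

Lemma set3_rot (i j k : 'I_N) : [set j; k; i]%SET = [set i; j; k]%SET.
Proof. by apply/finset.setP => x; rewrite !inE orbC orbA. Qed.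

Lemma set3_flip (i j k : 'I_N) : [set i; k; j]%SET = [set i; j; k]%SET.
Proof. by apply/finset.setP => x; rewrite !inE orbAC. Qed.

Lemma triple_sum_rot g : triple_sum (fun i j k => g j k i) = triple_sum g.
Proof.
rewrite /triple_sum.
transitivity (\sum_i \sum_j \sum_k (if [set i; j; k]%SET \in T then g j k i else 0)).
  by apply: eq_bigr => i _; apply: eq_bigr => j _; rewrite big_mkcond.
rewrite exchange_big; apply: eq_bigr => j _.
rewrite exchange_big; apply: eq_bigr => k _.
rewrite [RHS]big_mkcond; apply: eq_bigr => i _.
by rewrite (set3_rot i j k).
Qed.

Lemma eq_triple_sum g g' :
  (forall i j k, [set i; j; k]%SET \in T -> g i j k = g' i j k) ->
  triple_sum g = triple_sum g'.
Proof.
by move=> H; do 3 (apply: eq_bigr => ? ?); exact: H.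
Qed.

Lemma triple_sumD g g' :
  triple_sum (fun i j k => g i j k + g' i j k) = triple_sum g + triple_sum g'.
Proof.
rewrite /triple_sum -big_split; apply: eq_bigr => i _.
by rewrite -big_split; apply: eq_bigr => j _; rewrite -big_split.
Qed.

Lemma triple_sumZ (a : R) g :
  triple_sum (fun i j k => a * g i j k) = a * triple_sum g.
Proof.
rewrite /triple_sum mulr_sumr; apply: eq_bigr => i _.
by rewrite mulr_sumr; apply: eq_bigr => j _; rewrite mulr_sumr.
Qed.

Lemma le_triple_sum g g' :
  (forall i j k, [set i; j; k]%SET \in T -> g i j k <= g' i j k) ->
  triple_sum g <= triple_sum g'.
Proof. by move=> H; do 3 (apply: ler_sum => ? ?); exact: H. Qed.

(** Invariance under cyclic relabelling collects the contributions of the three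
    vertices of each triangle. *)
Lemma triple_sum_cycle g :
  3 * triple_sum g = triple_sum (fun i j k => g i j k + g j k i + g k i j).
Proof.
rewrite !triple_sumD (triple_sum_rot (fun i j k => g j k i)).
rewrite (triple_sum_rot g); ring.
Qed.

Lemma triple_neq (i j k : 'I_N) : [set i; j; k]%SET \in T -> [/\ i != j, i != k & j != k].
Proof.
move=> /T3 H.
have c2 (a b : 'I_N) : (#|[set a; b]%SET| <= 2)%N by rewrite cards2; case: (_ != _).
split; apply/eqP => E; move: H; rewrite E => H.
- by have := c2 j k; rewrite finset.setUid in H; rewrite H.
- by have := c2 k j; rewrite -set3_flip finset.setUid in H; rewrite H.
- by have := c2 i k; rewrite -finset.setUA finset.setUid in H; rewrite H.
Qed.

(** Passes from the triangles [i j k] with [j < k] used by the curvature to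
    ordered triples. *)
Lemma ordered_half_sum g i : (forall j k, g i j k = g i k j) ->
  \sum_j \sum_(k | [set i; j; k]%SET \in T) g i j k =
  2 * \sum_(j < N) \sum_(k < N | (j < k)%N && ([set i; j; k]%SET \in T)) g i j k.
Proof.
move=> gs.
have E j : \sum_(k | [set i; j; k]%SET \in T) g i j k =
    \sum_(k < N | (j < k)%N && ([set i; j; k]%SET \in T)) g i j k +
    \sum_(k < N | (k < j)%N && ([set i; k; j]%SET \in T)) g i k j.
  rewrite (bigID (fun k : 'I_N => j < k)%N) /=; congr (_ + _).
    by apply: eq_bigl => k; rewrite andbC.
  apply: eq_big => [k|k _]; last exact: gs.
  rewrite andbC (set3_flip i j k) -leqNgt leq_eqVlt; case: eqP => //= kj.
  rewrite kj ltnn /=; apply/negbTE/negP => /triple_neq[_ _].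
  by rewrite -val_eqE/= kj eqxx.
rewrite (eq_bigr _ (fun j _ => E j)) big_split/= [X in _ + X](_ : _ =
  \sum_(j < N) \sum_(k < N | (j < k)%N && ([set i; j; k]%SET \in T)) g i j k).
  by rewrite -mulr2n mulr_natl.
under eq_bigr do rewrite big_mkcond.
by rewrite exchange_big; apply: eq_bigr => j _; rewrite -big_mkcond.
Qed.

Lemma card_third (f : {set 'I_N}) (i j : 'I_N) : #|f| = 3%N ->
  #|[set k | [set i; j; k] == f]%SET| = [&& i \in f, j \in f & i != j].
Proof.
move=> f3; case: (boolP [&& _, _ & _]) => [/and3P[fi fj ij]|H].
  have /cards1P[c fc] : #|f :\ i :\ j|%SET == 1%N.
    have := cardsD1 i f; have := cardsD1 j (f :\ i)%SET.
    by rewrite f3 fi !inE fj eq_sym ij /= => -> ; rewrite !add1n => -[<-].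
  rewrite (_ : [set k | _]%SET = [set c]%SET) ?cards1//.
  have cf : [&& c != j, c != i & c \in f].
    have : c \in (f :\ i :\ j)%SET by rewrite fc inE.
    by rewrite !inE.
  apply/finset.setP => k; rewrite !inE; apply/eqP/eqP => [E|->].
    have : k \in f by rewrite -E !inE eqxx orbT.
    have [_ ik jk] : [/\ i != j, i != k & j != k].
      have c2 (a b : 'I_N) : (#|[set a; b]%SET| <= 2)%N by rewrite cards2; case: (_ != _).
      split=> //; apply/eqP => E'; move: f3; rewrite -E E' => H.
      - by have := c2 k j; rewrite -set3_flip finset.setUid in H; rewrite H.
      - by have := c2 i k; rewrite -finset.setUA finset.setUid in H; rewrite H.
    move=> kf; have : k \in (f :\ i :\ j)%SET by rewrite !inE kf eq_sym jk eq_sym ik.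
    by rewrite fc inE => /eqP.
  apply/finset.setP => x; rewrite !inE.
  have := fc => /finset.setP/(_ x); rewrite !inE.
  case: (eqVneq x i) => [->|xi]; first by rewrite fi.
  by case: (eqVneq x j) => [->|xj]; first by rewrite fj.
rewrite (_ : [set k | _]%SET = finset.set0) ?cards0//.
apply/finset.setP => k; rewrite !inE; apply/negbTE; apply: contra H => /eqP E.
rewrite -E !inE !eqxx orbT/=; apply/eqP => ij; move: f3; rewrite -E ij finset.setUid.
by rewrite cards2; case: (_ != _).
Qed.

Lemma triple_sum1 : triple_sum (fun _ _ _ => 1) = 6 * #|T|%:R.
Proof.
rewrite /triple_sum.
transitivity (\sum_(f in T) \sum_i \sum_j (#|[set k | [set i; j; k] == f]%SET|)%:R : R).
  rewrite [RHS]exchange_big; apply: eq_bigr => i _.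
  rewrite [RHS]exchange_big; apply: eq_bigr => j _.
  under [RHS]eq_bigr do rewrite -sum1_card natr_sum big_mkcond/=.
  rewrite [RHS]exchange_big big_mkcond/=; apply: eq_bigr => k _.
  case: ifP => kT.
    rewrite (bigD1 _ kT)/= !inE eqxx big1 ?addr0// => f /andP[_ fk].
    by rewrite inE eq_sym (negbTE fk).
  by rewrite big1// => f fT; rewrite inE; case: eqP => // E; rewrite E fT in kT.
transitivity (\sum_(f in T) (6 : R)); last by rewrite sumr_const mulr_natr.
apply: eq_bigr => f fT; have f3 := T3 fT.
transitivity (\sum_(i in f) (2 : R)); last first.
  by rewrite sumr_const f3; ring.
rewrite [RHS]big_mkcond; apply: eq_bigr => i _.
transitivity (\sum_j [&& i \in f, j \in f & i != j]%:R : R).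
  by apply: eq_bigr => j _; rewrite card_third.
case: ifP => fi; last by rewrite big1.
transitivity (\sum_(j in (f :\ i)%SET) (1 : R)).
  rewrite [RHS]big_mkcond; apply: eq_bigr => j _; rewrite !inE (eq_sym j) /= andbC.
  by case: (_ && _).
have := cardsD1 i f; rewrite f3 fi add1n => -[E].
by rewrite sumr_const -E.
Qed.
End TripleSums.

Section SurfaceCombinatorics.
Variables (N : nat) (T : {set {set 'I_N}}).

(** This is where polygons with at least three vertices are needed: a 2-gon
    would give the same triangle twice. *)
Lemma next_next_neq (c : seq 'I_N) w : uniq c -> (3 <= size c)%N -> w \in c ->
  next c (next c w) != w.
Proof.
move=> uc sc wc; have [n s Es] := rot_to wc.
rewrite -!(next_rot n uc) Es.
have : (3 <= size (w :: s))%N by rewrite -Es size_rot.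
have : uniq (w :: s) by rewrite -Es rot_uniq.
case: s {Es} => [|x [|z s]]//= /and4P[].
rewrite !inE !negb_or => /and3P[wx wz _] _ _ _ _.
rewrite eqxx; have := wx; rewrite eq_sym => /negbTE->; by rewrite eqxx eq_sym.
Qed.

(** Both the triangles and the edges at [v] are in bijection with the vertices of
    the polygon [c]. *)
Lemma card_link (v : 'I_N) (c : seq 'I_N) :
  uniq c -> (3 <= size c)%N -> v \notin c ->
  [set f in T | v \in f]%SET = [set [set v; w; next c w] | w in c]%SET ->
  #|[set f in T | v \in f]%SET| = size c /\
  #|[set e in edges T | v \in e]%SET| = size c.
Proof.
move=> uc sc vc star.
have nc w : w \in c -> next c w \in c by rewrite mem_next.
have vn w : w \in c -> v != w by move=> wc; apply: contra vc => /eqP->.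
split.
  rewrite star card_in_imset; first by rewrite (card_uniqP uc).
  move=> w w' wc w'c E.
  have : w \in [set v; w'; next c w']%SET by rewrite -E !inE eqxx orbT.
  rewrite !inE eq_sym (negbTE (vn _ wc))/= => /orP[/eqP//|/eqP wn].
  have : w' \in [set v; w; next c w]%SET by rewrite E !inE eqxx orbT.
  rewrite !inE eq_sym (negbTE (vn _ w'c))/= => /orP[/eqP//|/eqP w'n].
  by have := next_next_neq uc sc wc; rewrite -w'n -wn eqxx.
rewrite (_ : [set e in _ | _]%SET = [set [set v; w] | w in c]%SET).
  rewrite card_in_imset; first by rewrite (card_uniqP uc).
  move=> w w' wc w'c E.
  have : w \in [set v; w']%SET by rewrite -E !inE eqxx orbT.
  by rewrite !inE eq_sym (negbTE (vn _ wc))/= => /eqP.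
apply/finset.setP => e; rewrite !inE; apply/idP/imsetP => [/andP[/andP[e2 /existsP[f]]]|[w wc ->]].
  move=> /andP[fT /fintype.subsetP ef] ve.
  have : f \in [set f in T | v \in f]%SET by rewrite inE fT ef.
  rewrite star => /imsetP[w wc fE].
  have /cards1P[x ex] : #|e :\ v|%SET == 1%N.
    by have := cardsD1 v e; rewrite (eqP e2) ve add1n => -[<-].
  have eE : e = [set v; x]%SET by rewrite -ex finset.setD1K.
  exists x => //; have : x \in (e :\ v)%SET by rewrite ex inE.
  rewrite !inE => /andP[xv /ef]; rewrite fE !inE (negbTE xv)/=.
  by case/orP => /eqP->//; exact: nc.
have wf : [set v; w; next c w]%SET \in [set f in T | v \in f]%SET.
  by rewrite star; apply/imsetP; exists w.
move: wf; rewrite inE => /andP[fT _].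
rewrite cards2 vn//= !inE eqxx andbT; apply/existsP; exists [set v; w; next c w]%SET.
by rewrite fT/= finset.subsetUl.
Qed.

Lemma sum_degrees (A : {set {set 'I_N}}) (m : nat) : (forall f, f \in A -> #|f| = m) ->
  (\sum_v #|[set f in A | v \in f]%SET| = m * #|A|)%N.
Proof.
move=> Am; under eq_bigr do rewrite -sum1_card.
transitivity (\sum_(f in A) \sum_(v in f) 1)%N.
  rewrite (exchange_big_dep (mem A))/=.
    apply: eq_bigr => f fA; apply: eq_bigl => v; rewrite inE fA//.
  by move=> v f _; rewrite inE => /andP[].
under eq_bigr => f fA do rewrite sum1_card Am//.
by rewrite sum_nat_const mulnC.
Qed.

(** At every vertex there are as many edges as triangles; sum over the vertices. *)
Lemma edges_triangles : (forall f, f \in T -> #|f| = 3%N) ->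
  (forall v, link_is_cycle T v) -> (2 * #|edges T| = 3 * #|T|)%N.
Proof.
move=> T3 lk; rewrite -(sum_degrees T3) -(@sum_degrees _ 2).
  by apply: eq_bigr => v _; have [c [uc sc vc /(card_link uc sc vc)[-> ->]]] := lk v.
by move=> e; rewrite inE => /andP[/eqP].
Qed.
End SurfaceCombinatorics.

(** * A Poincare inequality on the 1-skeleton *)

Section Poincare.
Variables (R : realType) (N : nat) (T : {set {set 'I_N}}).
Hypothesis hT : closed_surface_triangulation T.
Implicit Types y : 'I_N -> R.

Definition dirichlet y : R :=
  triple_sum T (fun i j k => (y j - y i) ^+ 2 + (y k - y i) ^+ 2).

Lemma dirichlet_ge0 y : 0 <= dirichlet y.
Proof.
by rewrite /dirichlet /triple_sum; do 3 (apply: sumr_ge0 => ? _); rewrite addr_ge0 ?sqr_ge0.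
Qed.

Lemma edge_dirichlet y (a b : 'I_N) : [set a; b]%SET \in edges T ->
  (y b - y a) ^+ 2 <= dirichlet y.
Proof.
case: hT => _ T3 _ _; rewrite !inE => /andP[/eqP ab2 /existsP[f /andP[fT abf]]].
have /cards1P[c fc] : #|f :\: [set a; b]|%SET == 1%N.
  by rewrite cardsDS// ab2 T3.
have fE : f = [set a; b; c]%SET.
  by rewrite -fc -[LHS](finset.setID f [set a; b]%SET) (finset.setIidPr abf).
have q0 (x z : R) : 0 <= x ^+ 2 + z ^+ 2 by rewrite addr_ge0 ?sqr_ge0.
rewrite /dirichlet /triple_sum (bigD1 a)//= (bigD1 b)//= (bigD1 c) -?fE//=.
rewrite -!addrA lerDl addr_ge0 ?sqr_ge0// !addr_ge0//;
by do ? (apply: sumr_ge0 => ? _); rewrite ?q0.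
Qed.

(** Along an edge path, (x + y)^2 <= 2 x^2 + 2 y^2 accumulates a constant that
    depends on the path only. *)
Lemma path_dirichlet (a b : 'I_N) :
  exists C : R, 0 <= C /\ forall y, (y b - y a) ^+ 2 <= C * dirichlet y.
Proof.
case: (hT) => _ _ _ /(_ a b)/connectP[p + ->].
elim: p a => [|c p IH] a /=.
  by exists 0; split => // y; rewrite subrr expr0n mul0r.
move=> /andP[ac /IH[C [C0 HC]]]; exists (2 * C + 2); split; first by lra.
move=> y; have := HC y; have := edge_dirichlet y ac.
have := sqr_ge0 (y (last c p) - y c - (y c - y a)); nra.
Qed.

(** For [y] of zero sum, the sum of (y b - y a)^2 over all pairs is 2 N times the
    sum of the squares. *)
Lemma poincare : exists2 C : R, 0 < C &
  forall y, \sum_i y i = 0 -> \sum_i y i ^+ 2 <= C * dirichlet y.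
Proof.
have [Cab HC] : exists Cab : 'I_N -> 'I_N -> R,
    forall a b, 0 <= Cab a b /\ forall y, (y b - y a) ^+ 2 <= Cab a b * dirichlet y.
  by exists (fun a => projT1 (choice (path_dirichlet a))) => a;
    exact: projT2 (choice (path_dirichlet a)).
have N0 : 0 < N%:R :> R by rewrite ltr0n; case: hT.
have S0 : 0 <= \sum_a \sum_b Cab a b.
  by apply: sumr_ge0 => a _; apply: sumr_ge0 => b _; case: (HC a b).
exists (\sum_a \sum_b Cab a b + 1); first by lra.
move=> y y0; have D0 := dirichlet_ge0 y.
have E : \sum_a \sum_b (y b - y a) ^+ 2 = 2 * N%:R * \sum_i y i ^+ 2.
  transitivity (\sum_a (N%:R * y a ^+ 2 + \sum_i y i ^+ 2)).
    apply: eq_bigr => a _.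
    transitivity (\sum_(b < N) (y a ^+ 2 + y b ^+ 2 - 2 * y a * y b)).
      by apply: eq_bigr => b _; ring.
    by rewrite sumrB -mulr_sumr y0 mulr0 subr0 big_split/= sumr_const card_ord mulr_natl.
  by rewrite big_split/= sumr_const card_ord -mulr_sumr -mulr_natl; ring.
have le1 : \sum_a \sum_b (y b - y a) ^+ 2 <= (\sum_a \sum_b Cab a b) * dirichlet y.
  rewrite mulr_suml; apply: ler_sum => a _; rewrite mulr_suml; apply: ler_sum => b _.
  by case: (HC a b).
have s0 : 0 <= \sum_i y i ^+ 2 by apply: sumr_ge0 => i _; exact: sqr_ge0.
have N1 : 1 <= N%:R :> R by rewrite ler1n; case: hT.
rewrite E in le1; nra.
Qed.
End Poincare.

(** * The curvature of a PL metric and its derivative *)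

Section Curvature.
Variables (R : realType) (N : nat) (T : {set {set 'I_N}}).
Hypothesis hT : closed_surface_triangulation T.
Implicit Types (l d : {set 'I_N} -> R) (y w : 'I_N -> R).

Let T3 f : f \in T -> #|f| = 3%N. Proof. by case: hT => _ H _ _; exact: H. Qed.

Lemma inner_angleE l (i j k : 'I_N) : inner_angle l i j k =
  acos (law_cos (l [set j; k]%SET) (l [set i; k]%SET) (l [set i; j]%SET)).
Proof. by []. Qed.

Lemma set2C (i j : 'I_N) : [set i; j]%SET = [set j; i]%SET.
Proof. exact: finset.setUC. Qed.

Lemma inner_angle_flip l (i j k : 'I_N) : inner_angle l i j k = inner_angle l i k j.
Proof.
rewrite !inner_angleE (set2C k j); congr acos; rewrite /law_cos.
by congr (_ / _); ring.
Qed.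

Lemma PL_triangle l (i j k : 'I_N) : PL_metric T l -> [set i; j; k]%SET \in T ->
  triangle_ineqs (l [set j; k]%SET) (l [set i; k]%SET) (l [set i; j]%SET).
Proof.
move=> [_ H] t.
have t1 : [set j; k; i]%SET \in T by rewrite set3_rot.
have t2 : [set i; k; j]%SET \in T by rewrite set3_flip.
have := H _ _ _ t; have := H _ _ _ t1; have := H _ _ _ t2.
rewrite (set2C k j) (set2C j i).
by split; lra.
Qed.

Lemma triangle_edge (i j k : 'I_N) : [set i; j; k]%SET \in T -> i != j ->
  [set i; j]%SET \in edges T.
Proof.
move=> t ij; rewrite inE cards2 ij /=; apply/existsP; exists [set i; j; k]%SET.
by rewrite t finset.subsetUl.
Qed.

Lemma triangle_angle_sum l (i j k : 'I_N) : PL_metric T l -> [set i; j; k]%SET \in T ->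
  inner_angle l i j k + inner_angle l j k i + inner_angle l k i j = pi.
Proof.
move=> hl t; rewrite -(angle_sum (PL_triangle hl t)) !inner_angleE.
by rewrite (set2C k i) (set2C j i) (set2C k j).
Qed.

Lemma curvatureE l (i : 'I_N) : curvature T l i =
  2 * pi - 2^-1 * \sum_j \sum_(k | [set i; j; k]%SET \in T) inner_angle l i j k.
Proof.
rewrite (ordered_half_sum T3 (g := inner_angle l)); last by move=> j k; exact: inner_angle_flip.
by rewrite mulKf.
Qed.

Lemma gauss_bonnet l : PL_metric T l ->
  \sum_i curvature T l i = 2 * pi * (euler_char T)%:~R.
Proof.
move=> hl; under eq_bigr do rewrite curvatureE.
rewrite sumrB sumr_const card_ord -mulr_sumr -/(triple_sum T (inner_angle l)).
have E3 : 3 * triple_sum T (inner_angle l) = pi * (6 * #|T|%:R).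
  rewrite triple_sum_cycle -(triple_sum1 R T3) -triple_sumZ.
  by apply: eq_triple_sum => i j k t; rewrite mulr1 triangle_angle_sum.
have ET : 2 * (#|edges T|)%:R = 3 * #|T|%:R :> R.
  by rewrite -!natrM edges_triangles//; case: hT.
rewrite /euler_char rmorphD rmorphB/= -!pmulrn -mulr_natr.
set e := (#|edges T|)%:R in ET *; set f := (#|T|)%:R in ET E3 *.
(* chi = N - f / 2 since e = 3 f / 2, while the angles add up to pi f. *)
have -> : e = 3 / 2 * f by lra.
have -> : triple_sum T (inner_angle l) = 2 * pi * f by lra.
by field.
Qed.

Lemma sum_curvature_excess l : PL_metric T l ->
  \sum_i (curvature T l i - average_curvature R T) = 0.
Proof.
move=> hl; rewrite sumrB gauss_bonnet// sumr_const card_ord /average_curvature.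
have N0 : N%:R != 0 :> R by rewrite pnatr_eq0 -lt0n; case: hT.
by rewrite -[X in _ - X]mulr_natr divfK// subrr.
Qed.

Lemma curvature_bound l i : PL_metric T l ->
  `|curvature T l i| <= 2 * pi + (N * N)%:R * pi.
Proof.
move=> hl; rewrite /curvature; set s := \sum_(j < N) _.
have pi0 := pi_ge0 R.
suff /andP[s0 s1] : 0 <= s <= (N * N)%:R * pi.
  by rewrite ler_norml; apply/andP; split; lra.
have ang j k : [set i; j; k]%SET \in T -> 0 <= inner_angle l i j k <= pi.
  move=> t; rewrite inner_angleE.
  have /andP[h1 h2] := law_cos_itv (PL_triangle hl t).
  by rewrite acos_ge0 ?acos_lepi// !ltW.
apply/andP; split.
  by apply: sumr_ge0 => j _; apply: sumr_ge0 => k /andP[_ /ang/andP[]].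
apply: (@le_trans _ _ (\sum_(j < N) \sum_(k < N) pi)); last first.
  by rewrite !sumr_const !card_ord -mulrnA mulr_natl.
apply: ler_sum => j _; rewrite big_mkcond; apply: ler_sum => k _.
by case: ifP => // /andP[_ /ang/andP[]].
Qed.

Lemma conformal_edge y d (i j : 'I_N) : i != j ->
  conformal_mul y d [set i; j]%SET = y i * y j * d [set i; j]%SET.
Proof. by move=> ij; rewrite /conformal_mul big_setU1 ?inE//= big_set1. Qed.

Lemma lipschitz_near_conformal y d e :
  lipschitz_near y (fun z => conformal_mul z d e).
Proof.
apply: lipschitz_nearM; last exact: lipschitz_near_cst.
by apply: lipschitz_near_prod => i _; exact: lipschitz_near_coord.
Qed.

(** The cosines of the angles lie strictly between -1 and 1 and are rational in
    the conformal factor. *)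
Lemma lipschitz_near_curvature y d (i : 'I_N) : PL_metric T (conformal_mul y d) ->
  lipschitz_near y (fun z => curvature T (conformal_mul z d) i).
Proof.
move=> hy; apply: lipschitz_nearD; first exact: lipschitz_near_cst.
apply: lipschitz_nearN; apply: lipschitz_near_sum => j _.
apply: lipschitz_near_sum => k /andP[_ t].
have tri := PL_triangle hy t; have [a0 b0 c0] := triangle_pos tri.
have conf := lipschitz_near_conformal y d.
have lcst := @lipschitz_near_cst R 'I_N y.
apply: (lipschitz_near_acos (law_cos_itv tri)).
have sq e : lipschitz_near y (fun z => conformal_mul z d e ^+ 2).
  exact: lipschitz_nearM (conf e) (conf e).
apply: lipschitz_nearM.
  apply: lipschitz_nearD; last exact: lipschitz_nearN.
  exact: lipschitz_nearD.
have den : 2 * conformal_mul y d [set i; k]%SET * conformal_mul y d [set i; j]%SET != 0.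
  by rewrite gt_eqF// (mulr_gt0 (mulr_gt0 _ b0) c0).
exact: (lipschitz_nearV den (lipschitz_nearM (lipschitz_nearM (lcst 2) (conf _)) (conf _))).
Qed.

(** The derivative of the angle at [i] found in [is_derive_angle], for the metric
    [l] and logarithmic rates [w] of the conformal factor. *)
Definition angle_rate l w (i j k : 'I_N) : R :=
  let a := l [set j; k]%SET in let b := l [set i; k]%SET in let c := l [set i; j]%SET in
  (Num.sqrt (heron a b c))^-1 *
  ((a ^+ 2 + b ^+ 2 - c ^+ 2) * (w j - w i) + (a ^+ 2 + c ^+ 2 - b ^+ 2) * (w k - w i)).

Lemma angle_rate_flip l w (i j k : 'I_N) : angle_rate l w i j k = angle_rate l w i k j.
Proof.
rewrite /angle_rate (set2C k j).
set a := l [set j; k]%SET; set b := l [set i; k]%SET; set c := l [set i; j]%SET.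
have -> : heron a c b = heron a b c by rewrite /heron; ring.
by congr (_ * _); ring.
Qed.

Lemma is_derive_curvature (d : {set 'I_N} -> R) (u : R -> 'I_N -> R) w (t : R) (i : 'I_N) :
  PL_metric T (conformal_mul (u t) d) ->
  (forall j, is_derive t 1 (u ^~ j) (u t j * w j)) ->
  is_derive t 1 (fun s => curvature T (conformal_mul (u s) d) i)
    (- (2^-1 * \sum_j \sum_(k | [set i; j; k]%SET \in T)
                 angle_rate (conformal_mul (u t) d) w i j k)).
Proof.
move=> hu du.
rewrite (ordered_half_sum T3 (g := angle_rate _ w)); last by move=> *; exact: angle_rate_flip.
rewrite mulKf// -[- _]add0r.
apply: is_deriveB; apply: is_derive_big => j _; apply: is_derive_big => k /andP[_ tr].
have edge (a b : 'I_N) : a != b -> is_derive t 1 (fun s => conformal_mul (u s) d [set a; b]%SET)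
    (conformal_mul (u t) d [set a; b]%SET * (w a + w b)).
  move=> ab; rewrite (_ : (fun s => _) = (u ^~ a * u ^~ b) * cst (d [set a; b]%SET)).
    apply: (is_derive_eq (is_deriveM (is_deriveM (du a) (du b)) (is_derive_cst _ _ _))).
    by rewrite conformal_edge// /GRing.scale/=; ring.
  by apply/funext => s; rewrite conformal_edge.
have [ij ik jk] := triple_neq T3 tr.
exact: (@is_derive_angle R (fun s => conformal_mul (u s) d [set j; k]%SET)
  (fun s => conformal_mul (u s) d [set i; k]%SET)
  (fun s => conformal_mul (u s) d [set i; j]%SET) t (w i) (w j) (w k)
  (PL_triangle hu tr) (edge _ _ jk) (edge _ _ ik) (edge _ _ ij)).
Qed.

(** Strict convexity of the curvature functional, uniform in terms of the margin
    [delta] in the triangle inequalities and of a bound [B] on the edge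
    lengths: the left-hand side is minus the derivative of the curvature in the
    direction [w], paired with [w]. *)
Lemma curvature_energy (C : R) l w delta B : 0 < C -> B != 0 ->
  (forall y, \sum_i y i = 0 -> \sum_i y i ^+ 2 <= C * dirichlet T y) ->
  0 < delta ->
  (forall i j k, [set i; j; k]%SET \in T ->
     delta <= l [set i; k]%SET + l [set k; j]%SET - l [set i; j]%SET) ->
  (forall e, e \in edges T -> l e <= B) ->
  \sum_i w i = 0 ->
  \sum_i w i * (2^-1 * \sum_j \sum_(k | [set i; j; k]%SET \in T) angle_rate l w i j k)
  <= - (delta ^+ 2 / (24 * C * B ^+ 2) * \sum_i w i ^+ 2).
Proof.
move=> C0 B0 poin d0 gap lB w0.
set G := fun i j k => w i * angle_rate l w i j k.
rewrite [leLHS](_ : _ = 2^-1 * triple_sum T G); last first.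
  rewrite mulr_sumr; apply: eq_bigr => i _; rewrite mulrCA; congr (_ * _).
  rewrite mulr_sumr; apply: eq_bigr => j _; exact: mulr_sumr.
have E3 : 3 * triple_sum T G <= - (delta ^+ 2 / (4 * B ^+ 2) * dirichlet T w).
  rewrite triple_sum_cycle -mulNr -triple_sumZ; apply: le_triple_sum => i j k t.
  have t1 : [set j; k; i]%SET \in T by rewrite set3_rot.
  have t2 : [set i; k; j]%SET \in T by rewrite set3_flip.
  have := gap _ _ _ t; have := gap _ _ _ t1; have := gap _ _ _ t2.
  have [ij ik _] := triple_neq T3 t.
  have := lB _ (triangle_edge t ij); have := lB _ (triangle_edge t2 ik).
  rewrite /G /angle_rate (set2C k j) (set2C j i) (set2C k i) mulNr => *.
  by apply: angle_energy; lra.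
have P := poin _ w0.
set D := dirichlet T w in E3 P; set W := \sum_i w i ^+ 2 in P *.
have k0 : 0 <= delta ^+ 2 / (4 * B ^+ 2).
  by rewrite divr_ge0 ?sqr_ge0// pmulr_rge0// sqr_ge0.
have -> : delta ^+ 2 / (24 * C * B ^+ 2) * W = delta ^+ 2 / (4 * B ^+ 2) * (W / C) / 6.
  by field; rewrite B0 gt_eqF.
have {}P : W / C <= D by rewrite ler_pdivrMr// mulrC.
have := ler_wpM2l k0 P; lra.
Qed.
End Curvature.

(** * One-sided derivatives and the approach to the final time *)

Section TimeIntervals.
Variable R : realType.
Implicit Types (L : \bar R) (f : R -> R).

Lemma is_derive_of_quotient f (t l : R) :
  (f s - f t) / (s - t) @[s --> t^'] --> l -> is_derive t 1 f l.
Proof.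
move=> q; apply/is_derive1_caratheodory.
exists (fun z => if z == t then l else (f z - f t) / (z - t)); split.
- move=> z; case: eqVneq => [->|zt]; first by rewrite !subrr mulr0.
  by rewrite divfK// subr_eq0.
- apply/cvgrPdist_le => /= e e0.
  move/cvgrPdist_le: q => /(_ e e0) [r /= r0 q].
  exists r => //= z /= zr; rewrite eqxx; have [_|zt] := eqVneq z t.
    by rewrite subrr normr0 ltW.
  exact: q.
- by rewrite eqxx.
Qed.

Lemma quotient_of_is_derive f (t l : R) :
  is_derive t 1 f l -> (f s - f t) / (s - t) @[s --> t^'] --> l.
Proof.
move=> /is_derive1_caratheodory[g [fg cg <-]].
apply/cvgrPdist_le => /= e e0.
move/cvgrPdist_le: cg => /(_ e e0) [r /= r0 cg].
exists r => //= z /= zr zt; rewrite fg mulfK ?subr_eq0//.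
exact: cg.
Qed.

Lemma has_derivative_within_of_derive (D : set R) f (t l : R) :
  is_derive t 1 f l -> has_derivative_within D f t l.
Proof.
move=> /quotient_of_is_derive q; apply/cvgrPdist_le => /= e e0.
move/cvgrPdist_le: q => /(_ e e0) [r /= r0 q].
by exists r => //= z /= zr zt _; exact: q.
Qed.

Lemma has_derivative_within_local (D D' : set R) f g (t l e : R) : 0 < e ->
  (forall s, `|s - t| < e -> D' s -> D s /\ f s = g s) -> f t = g t ->
  has_derivative_within D f t l -> has_derivative_within D' g t l.
Proof.
move=> e0 DD ft /cvgrPdist_le q; apply/cvgrPdist_le => /= d d0.
have [r /= r0 {}q] := q _ d0.
exists (Num.min r e) => /=; first by rewrite lt_min r0.
move=> s /=; rewrite lt_min => /andP[sr se] st D's.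
rewrite distrC in se; have [Ds fs] := DD s se D's.
by rewrite -fs -ft; exact: q.
Qed.

Lemma time_interval_open L (t : R) : 0 < t -> time_interval L t ->
  exists2 e : R, 0 < e & forall s, `|s - t| < e -> time_interval L s.
Proof.
case: L => [r||] t0 [_].
- rewrite lte_fin => tL.
  exists (Num.min t (r - t)); first by rewrite lt_min t0 subr_gt0.
  move=> s; rewrite lt_min !ltr_norml => /andP[/andP[s1 s2] /andP[s3 s4]].
  by split; [lra|rewrite lte_fin; lra].
- exists t => // s; rewrite ltr_norml => /andP[s1 s2].
  by split; [lra|exact: ltry].
- by rewrite ltNge leNye.
Qed.

Lemma derive_interior L f (t l : R) : 0 < t -> time_interval L t ->
  has_derivative_within (time_interval L) f t l -> is_derive t 1 f l.
Proof.
move=> t0 tL; have [e e0 He] := time_interval_open t0 tL.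
move=> /cvgrPdist_le q; apply: is_derive_of_quotient; apply/cvgrPdist_le => d d0.
have [r /= r0 {}q] := q _ d0.
exists (Num.min r e) => /=; first by rewrite lt_min r0.
move=> s /=; rewrite lt_min => /andP[sr se] st; apply: q => //.
by apply: He; rewrite distrC.
Qed.

Lemma derive_within0_cvg L f (l : R) : (0 < L)%E ->
  has_derivative_within (time_interval L) f 0 l -> f @ 0^'+ --> f 0.
Proof.
move=> L0 /cvgrPdist_le/(_ 1 ltr01)[r /= r0 q].
have [t1 t10 t1L] : exists2 t1 : R, 0 < t1 & forall s, 0 <= s -> s < t1 -> time_interval L s.
  case: L L0 {q} => [b||]//; rewrite ?lte_fin => b0.
    by exists b => // s s0 sb; split => //; rewrite lte_fin.
  by exists 1 => // s s0 sb; split => //; rewrite ltry.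
apply/cvgrPdist_le => /= e e0.
have l1 : 0 < `|l| + 1 by have := normr_ge0 l; lra.
exists (Num.min (Num.min r t1) (e / (`|l| + 1))) => /=.
  by rewrite !lt_min r0 t10 divr_gt0.
move=> s /=; rewrite !lt_min sub0r normrN => /andP[/andP[sr st] se] s0.
rewrite gtr0_norm// in sr st se.
have := q s; rewrite /= sub0r normrN gtr0_norm// subr0 gt_eqF// => /(_ sr isT).
move=> /(_ (t1L _ (ltW s0) st)) qs.
have Q : `|(f s - f 0) / s| <= `|l| + 1.
  have := le_trans (ler_normB l (l - (f s - f 0) / s)) (lerD (lexx _) qs).
  by rewrite subKr.
rewrite distrC -[f s - f 0](@divfK _ s) ?gt_eqF// normrM (gtr0_norm s0).
apply: (@le_trans _ _ ((`|l| + 1) * s)); first by rewrite ler_wpM2r// ltW.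
by move: se; rewrite ltr_pdivlMr// mulrC => /ltW.
Qed.

(** The filter of approach to the time [L], finite or infinite, from within
    [time_interval L]. *)
Definition before L : set_system R := [set P | exists t0 : R,
  time_interval L t0 /\ forall t, t0 <= t -> time_interval L t -> P t].

Lemma before_proper L : (0 < L)%E -> ProperFilter (before L).
Proof.
move=> L0; split.
  by move=> [t0 [t0L H]]; exact: (H t0 (lexx _) t0L).
split.
- by exists 0; split.
- move=> P Q [p [pL HP]] [q [qL HQ]]; exists (Num.max p q); split.
    by rewrite /Num.max; case: ifP.
  move=> t; rewrite ge_max => /andP[pt qt] tL.
  by split; [exact: HP|exact: HQ].
- move=> P Q PQ [p [pL HP]]; exists p; split => // t pt tL.
  by apply: PQ; exact: HP.
Qed.

(** Turns the absence of bad sequences, the form in which singularities are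
    excluded, into a bound that holds on a whole final segment of time. *)
Lemma before_of_no_sequence L (P : nat -> R -> Prop) : (0 < L)%E ->
  (~ exists t : nat -> R, [/\ forall n, time_interval L (t n),
       (t n)%:E @[n --> \oo] --> L & forall n, P n (t n)]) ->
  exists n, \forall t \near before L, ~ P n t.
Proof.
move=> L0 noseq; apply: contrapT => H; apply: noseq.
have {}H n t0 : exists t, time_interval L t0 -> [/\ t0 <= t, time_interval L t & P n t].
  have [t0L|] := pselect (time_interval L t0); last by exists 0.
  apply: contrapT => H'; apply: H; exists n, t0; split => // t t0t tL Pt.
  by apply: H'; exists t.
(* It suffices to look beyond the times s_n of one fixed sequence tending to L. *)
have [s [sL scvg]] : exists s : nat -> R, (forall n, time_interval L (s n)) /\
    forall t : nat -> R, (forall n, time_interval L (t n)) -> (forall n, s n <= t n) ->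
      (t n)%:E @[n --> \oo] --> L.
  case: L L0 {H} => [r||]//.
    rewrite lte_fin => r0; exists (fun n => r - r * n.+1%:R^-1); split.
      move=> n; split; last by rewrite lte_fin ltrBlDr ltrDl mulr_gt0.
      by rewrite subr_ge0 ler_piMr ?(ltW r0)// invf_le1// ler1n.
    move=> t tL st; apply: cvg_EFin; first exact: nearW.
    apply: (@squeeze_cvgr _ _ _ _ (fun n => r - r * n.+1%:R^-1) (fun=> r)).
    - apply: nearW => n; rewrite st/=; have [_] := tL n.
      by rewrite lte_fin => /ltW.
    - rewrite -[X in _ --> X]subr0; apply: cvgB; first exact: cvg_cst.
      by rewrite -[X in _ --> X](mulr0 r); exact: (cvgM (cvg_cst r) (@cvg_harmonic R)).
    - exact: cvg_cst.
  move=> _; exists (fun n => n%:R); split.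
    by move=> n; split => //; rewrite ltry.
  move=> t tL st; apply/cvgeyPge => A.
  exists (Num.bound A) => // n /= An; rewrite lee_fin; apply: le_trans (st n).
  apply: le_trans (ler_norm A) _; apply: le_trans (ltW (archi_boundP (normr_ge0 _))) _.
  by rewrite /Num.bound normr_id ler_nat.
pose t n := projT1 (cid (H n (s n))).
have Ht n := projT2 (cid (H n (s n))) (sL n).
exists t; split.
- by move=> n; case: (Ht n).
- by apply: scvg => n; case: (Ht n).
- by move=> n; case: (Ht n).
Qed.
End TimeIntervals.

(** * Conservation law and bounds along the flow *)

Section Flow.
Variables (R : realType) (N : nat) (T : {set {set 'I_N}}).
Hypothesis hT : closed_surface_triangulation T.
Variable d : {set 'I_N} -> R.
Hypothesis hd : PL_metric T d.

Let T3 f : f \in T -> #|f| = 3%N. Proof. by case: hT => _ H _ _; exact: H. Qed.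

Definition excess (y : 'I_N -> R) (i : 'I_N) : R :=
  curvature T (conformal_mul y d) i - average_curvature R T.

Definition gap (y : 'I_N -> R) (i j k : 'I_N) : R :=
  conformal_mul y d [set i; k]%SET + conformal_mul y d [set k; j]%SET
  - conformal_mul y d [set i; j]%SET.

Lemma gapE y (i j k : 'I_N) : [set i; j; k]%SET \in T ->
  gap y i j k = y i * d [set i; k]%SET * y k + y k * d [set k; j]%SET * y j
                - y i * d [set i; j]%SET * y j.
Proof.
move=> /(triple_neq T3)[ij ik jk]; rewrite eq_sym in jk.
by rewrite /gap !conformal_edge//; ring.
Qed.

Lemma conformal_factor_of_gaps y : (forall i, 0 < y i) ->
  (forall i j k, [set i; j; k]%SET \in T -> 0 < gap y i j k) ->
  conformal_factor T d y.
Proof.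
move=> y0 g0; split => //; split => [e eT|i j k t].
  rewrite /conformal_mul mulr_gt0//; first by apply: prodr_gt0 => i _.
  by case: hd => H _; exact: H.
by have := g0 _ _ _ t; rewrite /gap; lra.
Qed.

Lemma gap_gt0 y (i j k : 'I_N) : conformal_factor T d y ->
  [set i; j; k]%SET \in T -> 0 < gap y i j k.
Proof. by move=> [_ [_ H]] /H; rewrite /gap; lra. Qed.

Section Solution.
Variables (L : \bar R) (u : R -> 'I_N -> R).
Hypothesis hu : yamabe_solution T d L u.

Lemma L_gt0 : (0 < L)%E. Proof. by case: hu. Qed.

Lemma flow_conformal t : time_interval L t -> conformal_factor T d (u t).
Proof. by case: hu => _ H _ _; exact: H. Qed.

Lemma flow_derive t i : 0 < t -> time_interval L t ->
  is_derive t 1 (u ^~ i) (u t i * - excess (u t) i).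
Proof.
move=> t0 tL; rewrite mulrN -mulNr; apply: (derive_interior t0 tL).
by case: hu => _ _ _ H; exact: H.
Qed.

Lemma near_before_time : \forall t \near before L, 0 < t /\ time_interval L t.
Proof.
have [t1 t10 t1L] : exists2 t1 : R, 0 < t1 & time_interval L t1.
  case: L L_gt0 => [b||]//; rewrite ?lte_fin => b0.
    by exists (b / 2); [lra|split; [lra|rewrite lte_fin; lra]].
  by exists 1; [|split; [|rewrite ltry]].
by exists t1; split => // t t1t tL; split => //; exact: lt_le_trans t10 t1t.
Qed.

(** The derivative of sum_i ln u_i is minus the total excess curvature, which
    vanishes by Gauss-Bonnet. *)
Lemma sum_ln_constant s t : 0 < s -> s <= t -> time_interval L t ->
  \sum_i ln (u t i) = \sum_i ln (u s i).
Proof.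
move=> s0 st tL; apply/eqP; rewrite -subr_eq0 -normr_le0.
have tx x : s <= x <= t -> 0 < x /\ time_interval L x.
  move=> /andP[sx xt]; have x0 : 0 < x by exact: lt_le_trans s0 sx.
  split => //; split; first exact: ltW.
  by case: tL => _; apply: le_lt_trans; rewrite lee_fin.
have := @increment_bound R (fun r => \sum_i @ln R (u r i)) (fun=> 0) s t 0 st.
rewrite mul0r; apply => [x|x _].
  move=> /tx[x0 xL]; have [ux0 hx] := flow_conformal xL.
  have D i : is_derive x 1 (fun r => ln (u r i)) (- excess (u x) i).
    have K := @is_derive1_comp R (@ln R) (u ^~ i) x _ _ (is_derive1_ln (ux0 i)) (flow_derive i x0 xL).
    have K' : is_derive x 1 (fun r => ln (u r i)) ((u x i)^-1 * (u x i * - excess (u x) i)).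
      exact: K.
    apply: (is_derive_eq K').
    by rewrite mulrA mulVf ?mul1r// gt_eqF.
  apply: (is_derive_eq (@is_derive_big R _ (index_enum 'I_N) xpredT
    (fun i r => ln (u r i)) _ x (fun i _ => D i))).
  by rewrite sumrN (sum_curvature_excess hT hx) oppr0.
by rewrite normr0.
Qed.

(** The absence of an essential singularity gives [c], and that of a removable one
    gives [delta].  The upper bound [C] comes from the constancy of
    sum_i ln u_i: each term is controlled by lower bounds on the others. *)
Lemma bounded_of_no_singularity :
  ~ essential_singularity u L -> ~ removable_singularity T d u L ->
  exists c C delta : R, [/\ 0 < c, 0 < C, 0 < delta &
    \forall t \near before L, (forall i, c <= u t i <= C) /\
      forall i j k, [set i; j; k]%SET \in T -> delta <= gap (u t) i j k].
Proof.
move=> noess norem; have FF := before_proper L_gt0.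
have inv0 n : 0 < n.+1%:R^-1 :> R by rewrite invr_gt0.
have to0 (v : nat -> R) : (forall n, 0 < v n /\ v n <= n.+1%:R^-1) -> v n @[n --> \oo] --> 0.
  move=> H; apply: (@squeeze_cvgr _ _ _ _ (fun=> 0) (fun n => n.+1%:R^-1)).
  - by apply: nearW => n; have [/ltW-> ->] := H n.
  - exact: cvg_cst.
  - exact: cvg_harmonic.
have [c c0 nc] : exists2 c, 0 < c & \forall t \near before L, forall i, c <= u t i.
  apply: near_lower_bound => i.
  have [|n Hn] := @before_of_no_sequence R L (fun n t => u t i <= n.+1%:R^-1) L_gt0.
    move=> [t [tL tcvg tu]]; apply: noess; exists i, t; split => //.
    by apply: to0 => n; split => //; case: (flow_conformal (tL n)).
  exists n.+1%:R^-1 => //; apply: filterS Hn => t /negP; rewrite -ltNge; exact: ltW.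
have [C C0 nC] : exists2 C, 0 < C & \forall t \near before L, forall i, u t i <= C.
  have [t0 [t0L [t00 _]]] : exists t0, time_interval L t0 /\ 0 < t0 /\ time_interval L t0.
    have [t1 [t1L H]] := near_before_time.
    by exists t1; split => //; exact: H.
  exists (expR (\sum_i ln (u t0 i) + N%:R * `|ln c|)); first exact: expR_gt0.
  have nt0 : \forall t \near before L, t0 <= t by exists t0; split.
  have tm := near_before_time.
  near=> t; move=> i.
  have [t0t tL] : t0 <= t /\ time_interval L t by split; [near: t|near: t; apply: filterS tm => ? []].
  have [ut0 _] := flow_conformal tL.
  have ct : forall j, c <= u t j by near: t.
  rewrite -[u t i]lnK ?posrE// ler_expR -(sum_ln_constant t00 t0t tL).
  rewrite [\sum_i _](bigD1 i)//= -addrA lerDl.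
  have : \sum_(j | j != i) (- `|ln c|) <= \sum_(j | j != i) ln (u t j).
    apply: ler_sum => j _; have := ler_norm (- ln c); rewrite normrN.
    by have : ln c <= ln (u t j); [rewrite ler_ln ?posrE|lra].
  rewrite sumrN sumr_const -mulr_natl.
  have : (#|[pred j : 'I_N | j != i]|)%:R <= N%:R :> R.
    by rewrite ler_nat -[leqRHS]card_ord max_card.
  have := normr_ge0 (ln c); nra.
have [delta d0 nd] : exists2 delta, 0 < delta & \forall t \near before L,
    forall x : 'I_N * 'I_N * 'I_N, delta <=
      if [set x.1.1; x.1.2; x.2]%SET \in T then gap (u t) x.1.1 x.1.2 x.2 else 1.
  apply: near_lower_bound => -[[i j] k] /=.
  case: (boolP ([set i; j; k]%SET \in T)) => tr /=; last first.
    by exists 1 => //; apply: nearW.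
  have [|n Hn] := @before_of_no_sequence R L (fun n t => gap (u t) i j k <= n.+1%:R^-1 /\
      forall i, c <= u t i <= C) L_gt0.
    move=> [t [tL tcvg tu]]; apply: norem; exists t; split => //.
      move=> l; exists `[c, C]%classic; split.
      - exact: segment_compact.
      - by move=> x /=; rewrite in_itv/= => /andP[cx _]; exact: lt_le_trans c0 cx.
      - by move=> n /=; rewrite in_itv/=; exact: (tu n).2.
    exists i, j, k; split => //.
    under eq_fun do rewrite -gapE//.
    apply: to0 => n; split; last exact: (tu n).1.
    by apply: gap_gt0 => //; exact: flow_conformal.
  exists n.+1%:R^-1 => //; near=> t.
  rewrite leNgt; apply/negP => lt1.
  suff : ~ (gap (u t) i j k <= n.+1%:R^-1 /\ forall i, c <= u t i <= C).
    apply; split; first exact: ltW.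
    by move=> l; apply/andP; split; move: l; near: t.
  by near: t.
exists c, C, delta; split => //; near=> t; split.
  by move=> i; apply/andP; split; move: i; near: t.
move=> i j k tr; have : forall x : 'I_N * 'I_N * 'I_N, delta <=
      if [set x.1.1; x.1.2; x.2]%SET \in T then gap (u t) x.1.1 x.1.2 x.2 else 1 by near: t.
by move=> /(_ (i, j, k)); rewrite /= tr.
Unshelve. all: by end_near. Qed.

End Solution.
End Flow.

(** * Continuation of the flow beyond a finite time *)

Section Extension.
Variables (R : realType) (N : nat) (T : {set {set 'I_N}}).
Hypothesis hT : closed_surface_triangulation T.
Variable d : {set 'I_N} -> R.
Hypothesis hd : PL_metric T d.

Definition yamabe_field (y : 'I_N -> R) (i : 'I_N) : R := y i * - excess T d y i.

Lemma lipschitz_near_gap (y : 'I_N -> R) (i j k : 'I_N) :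
  lipschitz_near y (fun z => gap d z i j k).
Proof.
have conf := lipschitz_near_conformal y d.
by apply: lipschitz_nearD; [exact: lipschitz_nearD|exact: lipschitz_nearN].
Qed.

Lemma lipschitz_near_excess (y : 'I_N -> R) (i : 'I_N) : conformal_factor T d y ->
  lipschitz_near y (fun z => excess T d z i).
Proof.
move=> [_ hy]; apply: lipschitz_nearD; first exact: lipschitz_near_curvature.
exact: lipschitz_near_cst.
Qed.

Lemma lipschitz_near_field (y : 'I_N -> R) (i : 'I_N) : conformal_factor T d y ->
  lipschitz_near y (fun z => yamabe_field z i).
Proof.
move=> hy; apply: lipschitz_nearM; first exact: lipschitz_near_coord.
by apply: lipschitz_nearN; exact: lipschitz_near_excess.
Qed.

(** Uniform positive lower bounds survive in the limit. *)
Lemma conformal_factor_limit (X : Type) (F : set_system X) (FF : ProperFilter F)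
    (u : X -> 'I_N -> R) (y : 'I_N -> R) (c delta : R) : 0 < c -> 0 < delta ->
  (forall e, 0 < e -> \forall t \near F, forall i, `|u t i - y i| <= e) ->
  (\forall t \near F, (forall i, c <= u t i) /\
      forall i j k, [set i; j; k]%SET \in T -> delta <= gap d (u t) i j k) ->
  conformal_factor T d y.
Proof.
move=> c0 d0 uy near_u; apply: conformal_factor_of_gaps => // [i|i j k t].
  apply: lt_le_trans c0 _.
  have K : u x i @[x --> F] --> y i.
    exact: lipschitz_near_cvg (lipschitz_near_coord y i) uy.
  apply: (cvgr_to_ge K).
  by apply: filterS near_u => x [H _]; exact: H.
apply: lt_le_trans d0 _.
have K : gap d (u x) i j k @[x --> F] --> gap d y i j k.
  exact: lipschitz_near_cvg (lipschitz_near_gap y i j k) uy.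
apply: (cvgr_to_ge K).
by apply: filterS near_u => x [_ H]; exact: H.
Qed.

Lemma conformal_factor_open (y : 'I_N -> R) : conformal_factor T d y ->
  exists2 r : R, 0 < r & forall z, (forall i, `|z i - y i| <= r) -> conformal_factor T d z.
Proof.
move=> hy; have [y0 _] := hy.
have H1 i : exists2 r : R, 0 < r & forall z : 'I_N -> R, (forall j, `|z j - y j| <= r) -> 0 < z i.
  exact: (lipschitz_near_gt0 (lipschitz_near_coord y i)).
have H2 (x : 'I_N * 'I_N * 'I_N) : exists2 r : R, 0 < r &
    forall z : 'I_N -> R, (forall j, `|z j - y j| <= r) ->
      [set x.1.1; x.1.2; x.2]%SET \in T -> 0 < gap d z x.1.1 x.1.2 x.2.
  case: (boolP ([set x.1.1; x.1.2; x.2]%SET \in T)) => t; last by exists 1.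
  have [r r0 H] := lipschitz_near_gt0 (lipschitz_near_gap y x.1.1 x.1.2 x.2) (gap_gt0 hy t).
  by exists r => // z zr _; exact: H.
have [r1 r10 h1] := finite_positive_lower_bound
  (fun i => s2valP (cid2 (H1 i)) : 0 < s2val (cid2 (H1 i))).
have [r2 r20 h2] := finite_positive_lower_bound
  (fun x => s2valP (cid2 (H2 x)) : 0 < s2val (cid2 (H2 x))).
exists (Num.min r1 r2); first by rewrite lt_min r10.
move=> z zr; apply: conformal_factor_of_gaps => // [i|i j k t].
  apply: (s2valP' (cid2 (H1 i))) => j; apply: le_trans (zr j) _.
  by rewrite ge_min h1.
have zr2 l : `|z l - y l| <= s2val (cid2 (H2 (i, j, k))).
  by apply: le_trans (zr l) _; rewrite ge_min h2 orbT.
exact: (s2valP' (cid2 (H2 (i, j, k))) z zr2 t).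
Qed.

Lemma field_locally_lipschitz (y : 'I_N -> R) : conformal_factor T d y ->
  exists r L : R, [/\ 0 < r, 0 < L & forall z z' e,
    (forall i, `|z i - y i| <= r) -> (forall i, `|z' i - y i| <= r) ->
    (forall i, `|z i - z' i| <= e) -> forall i, `|yamabe_field z i - yamabe_field z' i| <= L * e].
Proof.
move=> hy; have H i : exists p : R * R, [/\ 0 < p.1, 0 <= p.2 & forall z z' e,
    (forall i, `|z i - y i| <= p.1) -> (forall i, `|z' i - y i| <= p.1) ->
    (forall i, `|z i - z' i| <= e) -> `|yamabe_field z i - yamabe_field z' i| <= p.2 * e].
  by have [r [L H]] := lipschitz_near_field i hy; exists (r, L).
pose p i := projT1 (cid (H i)); have Hp i := projT2 (cid (H i)).
have [r r0 hr] : exists2 r : R, 0 < r & forall i, r <= (p i).1.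
  by apply: finite_positive_lower_bound => i; case: (Hp i).
have p0 i : 0 <= (p i).2 by case: (Hp i).
have S0 : 0 <= \sum_i (p i).2 by apply: sumr_ge0.
exists r, (\sum_i (p i).2 + 1); split => //; first by lra.
move=> z z' e zr zr' zz' i; case: (Hp i) => _ _ K.
have e0 : 0 <= e := le_trans (normr_ge0 _) (zz' i).
apply: le_trans (K z z' e _ _ zz') _.
- by move=> j; apply: le_trans (zr j) (hr i).
- by move=> j; apply: le_trans (zr' j) (hr i).
rewrite ler_wpM2r// (bigD1 i)//= -addrA lerDl addr_ge0// sumr_ge0//.
Qed.

(** [picard] needs a globally Lipschitz bounded field, so the field is composed
    with the projection onto a box on which it is Lipschitz; a speed bound keeps
    the solution in the box, where the two fields agree. *)
Lemma local_solution (y : 'I_N -> R) : conformal_factor T d y ->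
  exists h : R, 0 < h /\ exists w : R -> 'I_N -> R, w 0 = y /\
    forall t, 0 <= t < h -> conformal_factor T d (w t) /\
      forall i, is_derive t 1 (w ^~ i) (yamabe_field (w t) i).
Proof.
move=> hy; have [r1 r10 hr1] := conformal_factor_open hy.
have [r2 [L [r20 L0 hL]]] := field_locally_lipschitz hy.
pose r := Num.min r1 r2; have r0 : 0 < r by rewrite lt_min r10.
have rr1 z : (forall i, `|z i - y i| <= r) -> forall i, `|z i - y i| <= r1.
  by move=> H i; apply: le_trans (H i) _; rewrite ge_min lexx.
have rr2 z : (forall i, `|z i - y i| <= r) -> forall i, `|z i - y i| <= r2.
  by move=> H i; apply: le_trans (H i) _; rewrite ge_min lexx orbT.
pose box (z : 'I_N -> R) i := clamp (y i - r) (y i + r) (z i).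
have box_in z i : `|box z i - y i| <= r.
  by rewrite ler_distl; apply: clamp_itv; lra.
have box_id z : (forall i, `|z i - y i| <= r) -> box z = z.
  by move=> H; apply/funext => i; apply: clamp_id; rewrite -ler_distl.
pose F z := yamabe_field (box z).
pose M := \sum_i `|yamabe_field y i| + L * r.
have M0 : 0 <= M.
  by rewrite addr_ge0 ?sumr_ge0// mulr_ge0// ltW.
have FM z i : `|F z i| <= M.
  have := hL (box z) y r (rr2 _ (box_in z)) _ (box_in z) i.
  move=> /(_ (fun j => _)) H; have {}H := H (fun j => _).
  have : `|yamabe_field (box z) i - yamabe_field y i| <= L * r.
    by apply: H => j; rewrite subrr normr0 ltW.
  have : `|yamabe_field y i| <= \sum_i `|yamabe_field y i|.
    by rewrite [leRHS](bigD1 i)//= lerDl sumr_ge0.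
  have := ler_normD (yamabe_field (box z) i - yamabe_field y i) (yamabe_field y i).
  by rewrite subrK /M /F; lra.
have FL z z' e : (forall i, `|z i - z' i| <= e) -> forall i, `|F z i - F z' i| <= L * e.
  move=> zz'; apply: hL; [exact/rr2|exact/rr2|move=> i].
  exact: le_trans (clamp_lip _ _ _ _) (zz' i).
have [h [h0 [w [w0 wd wb]]]] := picard L0 M0 FM FL y.
have M1 : 0 < M + 1 by lra.
exists (Num.min h (r / (M + 1))); split; first by rewrite lt_min h0 divr_gt0.
exists w; split => // t /andP[t0]; rewrite lt_min => /andP[th tr].
have t0h : 0 <= t < h by rewrite t0.
have wr i : `|w t i - y i| <= r.
  apply: le_trans (wb t i t0h) _.
  by move: tr; rewrite ltr_pdivlMr//; nra.
split; first by apply: hr1; exact: rr1.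
by move=> i; have := wd t i t0h; rewrite /F box_id.
Qed.

(** The speed is bounded on a final segment, so [u] has a limit at time [r]; the
    bounds make that limit a conformal factor, from which the flow restarts. *)
Lemma flow_extends (r : R) (u : R -> 'I_N -> R) (c C delta : R) :
  yamabe_solution T d r%:E u -> 0 < c -> 0 < C -> 0 < delta ->
  (\forall t \near before r%:E, (forall i, c <= u t i <= C) /\
      forall i j k, [set i; j; k]%SET \in T -> delta <= gap d (u t) i j k) ->
  exists h : R, 0 < h /\ exists v : R -> 'I_N -> R,
    yamabe_solution T d (r + h)%:E v /\
    forall t i, time_interval r%:E t -> v t i = u t i.
Proof.
move=> hu c0 C0 d0 bounds.
have r0 : 0 < r by have := L_gt0 hu; rewrite lte_fin.
have PF := before_proper (L_gt0 hu).
pose M := C * (2 * pi + (N * N)%:R * pi + `|average_curvature R T|).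
have [t0 [t0L ht0]] : exists t0, time_interval r%:E t0 /\ forall t, t0 <= t ->
    time_interval r%:E t -> [/\ 0 < t, forall i, c <= u t i <= C &
      forall i j k, [set i; j; k]%SET \in T -> delta <= gap d (u t) i j k].
  have : \forall t \near before r%:E, [/\ 0 < t, forall i, c <= u t i <= C &
      forall i j k, [set i; j; k]%SET \in T -> delta <= gap d (u t) i j k].
    by have := near_before_time hu; apply: filterS2 bounds => t [? ?] [? _]; split.
  by move=> [t0 [? ?]]; exists t0.
have t00 : 0 < t0 by case: (ht0 t0 (lexx _) t0L).
have t0r : t0 < r by case: t0L => _; rewrite lte_fin.
have inL t : t0 <= t -> t < r -> time_interval r%:E t.
  by move=> t0t tr; split; [lra|rewrite lte_fin].
have rate t i : t0 <= t -> t < r -> `|yamabe_field (u t) i| <= M.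
  move=> t0t tr; have tL := inL _ t0t tr; have [_ b _] := ht0 t t0t tL.
  have [_ hPL] := flow_conformal hu tL.
  rewrite /yamabe_field normrM normrN; apply: ler_pM => //.
    by have /andP[cu uC] := b i; rewrite ger0_norm//; lra.
  rewrite /excess; apply: le_trans (ler_normB _ _) _.
  by rewrite lerD2r; exact: curvature_bound.
have incr s t i : t0 <= s -> s <= t -> t < r -> `|u t i - u s i| <= M * (t - s).
  move=> t0s st tr.
  apply: (@increment_bound R (u ^~ i) (fun x => yamabe_field (u x) i)) => // x /andP[sx xt].
    by apply: (flow_derive hu); [lra|apply: inL; lra].
  by apply: rate; lra.
have [y Hy] : exists y : 'I_N -> R, forall i t, t0 <= t < r -> `|u t i - y i| <= M * (r - t).
  have H i : exists m, forall t, [set t | t0 <= t < r] t -> `|u t i - m| <= M * (r - t).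
    apply: (@exists_limit_within R R [set t | t0 <= t < r] (u ^~ i) (fun t => M * (r - t))).
      by exists t0 => /=; rewrite lexx.
    move=> s t /= /andP[t0s sr] /andP[t0t tr].
    have M0 : 0 <= M := le_trans (normr_ge0 _) (rate t i t0t tr).
    have [st|/ltW ts] := leP s t.
      by have := incr s t i t0s st tr; rewrite ler_norml => /andP[]; nra.
    by have := incr t s i t0t ts sr; rewrite ler_norml => /andP[]; nra.
  by exists (fun i => projT1 (cid (H i))) => i t; exact: (projT2 (cid (H i)) t).
have uy e : 0 < e -> exists2 t1, t0 <= t1 < r & forall t i, t1 <= t < r -> `|u t i - y i| <= e.
  move=> e0; have M1 : 0 < `|M| + 1 by have := normr_ge0 M; lra.
  exists (Num.max t0 (r - e / (`|M| + 1))).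
    by rewrite le_max lexx/= gt_max t0r/= ltrBlDr ltrDl divr_gt0.
  move=> t i /andP[]; rewrite ge_max => /andP[t0t et] tr.
  apply: le_trans (Hy i t _) _; first by rewrite t0t.
  have : r - t <= e / (`|M| + 1) by lra.
  rewrite ler_pdivlMr// mulrC; have := ler_norm M; nra.
have hy : conformal_factor T d y.
  apply: (conformal_factor_limit PF c0 d0 (u := u)).
    move=> e e0; have [t1 /andP[t01 t1r] H] := uy e e0; exists t1; split; first exact: inL.
    by move=> t t1t [_ tr] i; apply: H; rewrite t1t -lte_fin.
  by apply: filterS bounds => t [b ?]; split => // i; case/andP: (b i).
have [h [h0 [w [w0 hw]]]] := local_solution hy.
exists h; split => //.
(* The prolonged flow; v r = y, so that v is continuous at r. *)
pose v t := if t < r then u t else w (t - r).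
have vu t : t < r -> v t = u t by rewrite /v => ->.
have vw t : r <= t -> v t = w (t - r) by rewrite /v ltNge => ->.
have vr : v r = y by rewrite vw// subrr w0.
have vy e : 0 < e -> exists2 a, 0 < a & forall s, `|s - r| < a -> forall i, `|v s i - y i| <= e.
  move=> e0; have [t1 /andP[t01 t1r] Hu] := uy e e0.
  have : \forall s \near (0 : R), forall i, `|w s i - y i| <= e.
    apply: (@filter_forall R _ (fun i s => `|w s i - y i| <= e) (nbhs (0 : R)) _) => i.
    have h00 : 0 <= (0 : R) < h by rewrite lexx.
    have [_ /(_ i) dw] := hw 0 h00.
    have /cvgrPdist_le/(_ e e0) := is_derive_continuous dw.
    by apply: filterS => s; rewrite w0 distrC.
  move=> [a /= a0 Ha]; exists (Num.min a (r - t1)); first by rewrite lt_min a0 subr_gt0.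
  move=> s; rewrite lt_min => /andP[sa sr] i.
  have [sr'|rs] := ltP s r.
    by rewrite vu// Hu// sr' andbT; move: sr; rewrite ltr_norml => /andP[]; lra.
  by rewrite vw//; apply: Ha; rewrite /= sub0r normrN.
have dv_right s i : r < s -> s < r + h -> is_derive s 1 (v ^~ i) (yamabe_field (v s) i).
  move=> rs sh; have srh : 0 <= s - r < h by apply/andP; split; lra.
  have [_ /(_ i) dw] := hw _ srh.
  rewrite (vw _ (ltW rs)).
  apply: (@near_eq_is_derive _ _ _ (fun x => w (x - r) i)).
    by near=> x; rewrite vw// ltW//; near: x; exact: lt_nbhsr.
  have ds : is_derive s 1 (fun x => x - r) (1 : R).
    by apply: (is_derive_eq (is_deriveB (is_derive_id _ _) (is_derive_cst _ _ _))); rewrite subr0.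
  by apply: (is_derive_eq (@is_derive1_comp R (w ^~ i) (fun x => x - r) s _ _ dw ds)); rewrite mulr1.
have dv_left s i : 0 < s -> s < r -> is_derive s 1 (v ^~ i) (yamabe_field (v s) i).
  move=> s0 sr; rewrite vu//.
  apply: (@near_eq_is_derive _ _ _ (u ^~ i)).
    by near=> x; rewrite vu//; near: x; exact: lt_nbhsl.
  by apply: (flow_derive hu) => //; split; [exact: ltW|rewrite lte_fin].
have dv_r i : is_derive r 1 (v ^~ i) (yamabe_field (v r) i).
  have a0 : 0 < Num.min r h by rewrite lt_min r0.
  apply: (is_derive_of_punctured (df := fun s => yamabe_field (v s) i) a0).
  - apply/cvgrPdist_le => /= e e0; have [a a1 Ha] := vy e e0.
    by exists a => // s /= sa; rewrite vr distrC; apply: Ha; rewrite distrC.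
  - move=> s sr; rewrite lt_min !ltr_norml => /andP[/andP[? ?] /andP[? ?]].
    have [sr'|rs] := ltP s r; first by apply: dv_left => //; lra.
    by apply: dv_right; [rewrite lt_neqAle eq_sym sr|lra].
  - rewrite vr; apply: (lipschitz_near_cvg (lipschitz_near_field i hy)).
    move=> e e0; have [a a1 Ha] := vy e e0.
    by exists a => // s /= sa _; apply: Ha; rewrite distrC.
exists v; split; last by move=> t i [_]; rewrite lte_fin => /vu->.
split.
- by rewrite lte_fin; lra.
- move=> t [t0' th]; rewrite lte_fin in th; have [tr|rt] := ltP t r.
    by rewrite vu//; apply: (flow_conformal hu); split.
  have trh : 0 <= t - r < h by apply/andP; split; lra.
  by rewrite vw//; case: (hw _ trh).
- by move=> i; rewrite vu//; case: hu => _ _ ->.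
- move=> t i [t0' th]; rewrite lte_fin in th.
  have -> : - v t i * (curvature T (conformal_mul (v t) d) i - average_curvature R T)
    = yamabe_field (v t) i by rewrite /yamabe_field /excess mulNr mulrN.
  have [tr|rt] := ltP t r.
    have e0 : 0 < r - t by rewrite subr_gt0.
    apply: (has_derivative_within_local (D := time_interval r%:E) (f := u ^~ i) e0).
    + move=> s; rewrite ltr_norml => /andP[s1 s2] [s0 _].
      have sr : s < r by lra.
      by rewrite vu//; split => //; split.
    + by rewrite vu.
    + rewrite vu// /yamabe_field /excess mulrN -mulNr; case: hu => _ _ _; apply.
      by split.
  apply: has_derivative_within_of_derive.
  move: rt; rewrite le_eqVlt => /predU1P[<-|rt]; first exact: dv_r.
  exact: dv_right.
Unshelve. all: by end_near. Qed.
End Extension.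

(** * Exponential convergence *)

Section Convergence.
Variables (R : realType) (N : nat) (T : {set {set 'I_N}}).
Hypothesis hT : closed_surface_triangulation T.
Variable d : {set 'I_N} -> R.
Hypothesis hd : PL_metric T d.

Lemma time_interval_pinfty (t : R) : time_interval +oo t <-> 0 <= t.
Proof. by split => [[]//|t0]; split => //; exact: ltry. Qed.

Lemma conformal_edges_bounded (C : R) : exists2 B : R, 0 < B &
  forall y, (forall i, 0 <= y i <= C) -> forall e, e \in edges T -> conformal_mul y d e <= B.
Proof.
have S0 : 0 <= \sum_(e : {set 'I_N}) `|d e| by apply: sumr_ge0.
exists (C ^+ 2 * \sum_(e : {set 'I_N}) `|d e| + 1).
  by rewrite ltr_wpDl// mulr_ge0// sqr_ge0.
move=> y yC e; rewrite inE => /andP[/cards2P[a [b [ab ->]]] _].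
rewrite conformal_edge//.
have /andP[ya0 yaC] := yC a; have /andP[yb0 ybC] := yC b.
have yy : y a * y b <= C ^+ 2 by rewrite expr2 ler_pM.
have dS : d [set a; b]%SET <= \sum_(e : {set 'I_N}) `|d e|.
  rewrite (bigD1 [set a; b]%SET)//=; apply: le_trans (ler_norm _) _.
  by rewrite lerDl sumr_ge0.
have y0 : 0 <= y a * y b by rewrite mulr_ge0.
apply: (@le_trans _ _ (y a * y b * \sum_(e : {set 'I_N}) `|d e|)).
  by rewrite ler_wpM2l.
by have := ler_wpM2r S0 yy; lra.
Qed.

Variable u : R -> 'I_N -> R.
Hypothesis hu : yamabe_solution T d +oo u.

Definition excess_sq (s : R) : R := \sum_i excess T d (u s) i ^+ 2.

(** By [curvature_energy] in the direction [w i = - excess T d (u t) i], the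
    derivative of [excess_sq] is at most [- 2 * lam * excess_sq]. *)
Lemma excess_sq_decay (c C delta t0 : R) : 0 < c -> 0 < delta -> 0 < t0 ->
  (forall t, t0 <= t -> (forall i, c <= u t i <= C) /\
      forall i j k, [set i; j; k]%SET \in T -> delta <= gap d (u t) i j k) ->
  exists2 lam : R, 0 < lam & forall t, t0 <= t ->
    excess_sq t * expR (2 * lam * t) <= excess_sq t0 * expR (2 * lam * t0).
Proof.
move=> c0 d0 t00 bounds.
have [P P0 poin] := poincare R hT.
have [B B0 edgeB] := conformal_edges_bounded C.
pose lam := delta ^+ 2 / (24 * P * B ^+ 2).
have lam0 : 0 < lam by rewrite divr_gt0 ?exprn_gt0// !mulr_gt0// exprn_gt0.
exists lam => // t t0t.
pose K x i := - (2^-1 * \sum_j \sum_(k | [set i; j; k]%SET \in T)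
   angle_rate (conformal_mul (u x) d) (fun i => - excess T d (u x) i) i j k).
have tL x : t0 <= x -> time_interval +oo x by move=> ?; apply/time_interval_pinfty; lra.
have dex x i : t0 <= x -> is_derive x 1 (fun s => excess T d (u s) i) (K x i).
  move=> t0x; have [_ hx] := flow_conformal hu (tL _ t0x).
  have := is_derive_curvature hT i hx (fun j => flow_derive hu j (lt_le_trans t00 t0x) (tL _ t0x)).
  move=> D; rewrite -[K x i]subr0; exact: is_deriveB D (is_derive_cst _ _ _).
have dsq x : t0 <= x -> is_derive x 1 excess_sq (\sum_i 2 * excess T d (u x) i * K x i).
  move=> t0x; apply: (@is_derive_big R _ (index_enum 'I_N) xpredT
    (fun i s => excess T d (u s) i ^+ 2) _ x) => i _.
  by apply: (is_derive_eq (is_deriveX 2 (dex x i t0x))); rewrite /GRing.scale/= expr1.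
have energy x : t0 <= x ->
    \sum_i 2 * excess T d (u x) i * K x i <= - (2 * lam * excess_sq x).
  move=> t0x; have [_ hx] := flow_conformal hu (tL _ t0x).
  have [b g] := bounds x t0x.
  have u0C i : 0 <= u x i <= C by have /andP[? ?] := b i; apply/andP; split; lra.
  have w0 : \sum_i - excess T d (u x) i = 0.
    by rewrite sumrN (sum_curvature_excess hT hx) oppr0.
  have := curvature_energy hT P0 (lt0r_neq0 B0) poin d0 (g : forall i j k, _ -> delta <= _)
    (edgeB _ u0C) w0.
  rewrite -/lam; under [X in _ <= - (lam * X)]eq_bigr do rewrite sqrrN.
  rewrite -/(excess_sq x).
  have -> : \sum_i 2 * excess T d (u x) i * K x i = 2 * \sum_i (- excess T d (u x) i) *
    (2^-1 * \sum_j \sum_(k | [set i; j; k]%SET \in T)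
      angle_rate (conformal_mul (u x) d) (fun i => - excess T d (u x) i) i j k).
    by rewrite mulr_sumr; apply: eq_bigr => i _; rewrite /K; ring.
  by lra.
apply: (@derive_le0_nonincr R (fun s => excess_sq s * expR (2 * lam * s))
  (fun s => excess_sq s * (expR (2 * lam * s) * (2 * lam))
     + expR (2 * lam * s) * \sum_i 2 * excess T d (u s) i * K s i)) => // x /andP[t0x _].
  have de : is_derive x 1 (fun s => expR (2 * lam * s)) (expR (2 * lam * x) * (2 * lam)).
    have dl : is_derive x 1 (fun s : R => 2 * lam * s) (2 * lam).
      apply: (is_derive_eq (is_deriveM (is_derive_cst (2 * lam) x 1) (is_derive_id _ _))).
      by rewrite /GRing.scale/= mulr0 mulr1 addr0.
    exact: (@is_derive1_comp R (@expR R) (fun s => 2 * lam * s) x _ _ (is_derive_expR _) dl).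
  exact: (is_deriveM (dsq x t0x) de).
have := energy x t0x; have := expR_gt0 (2 * lam * x); nra.
Qed.

Lemma excess_decay (c C delta t0 : R) : 0 < c -> 0 < delta -> 0 < t0 ->
  (forall t, t0 <= t -> (forall i, c <= u t i <= C) /\
      forall i j k, [set i; j; k]%SET \in T -> delta <= gap d (u t) i j k) ->
  exists A lam : R, [/\ 0 < A, 0 < lam &
    forall t i, t0 <= t -> `|excess T d (u t) i| <= A * expR (- lam * t)].
Proof.
move=> c0 d0 t00 bounds; have [lam lam0 H] := excess_sq_decay c0 d0 t00 bounds.
have sq0 t : 0 <= excess_sq t by apply: sumr_ge0 => i _; exact: sqr_ge0.
set G := excess_sq t0 * expR (2 * lam * t0) in H.
have G0 : 0 <= G by rewrite mulr_ge0// expR_ge0.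
exists (G + 1), lam; split => //; first by lra.
move=> t i t0t; have := H t t0t; rewrite -ler_pdivlMr ?expR_gt0// => Ht.
have e0 := expR_gt0 (- lam * t).
rewrite -(ler_pXn2r (n := 2)) ?nnegrE ?mulr_ge0 ?expR_ge0//; last by lra.
rewrite real_normK ?num_real//.
apply: (@le_trans _ _ (excess_sq t)).
  by rewrite /excess_sq [leRHS](bigD1 i)//= lerDl sumr_ge0// => j _; exact: sqr_ge0.
have E : expR (- lam * t) ^+ 2 = expR (- (2 * lam * t)).
  by rewrite -expRM_natl; congr expR; ring.
apply: le_trans Ht _; rewrite -expRN exprMn E.
rewrite ler_wpM2r ?expR_ge0//; nra.
Qed.

(** With [A] and [lam] from [excess_decay], the speed of [u] is at most
    [C * A * expR (- lam * t)], so that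
    [u t i + D * expR (- lam * t)] decreases and [u t i - D * expR (- lam * t)]
    increases, with [D = C * A / lam]. *)
Lemma flow_converges (c C delta t0 : R) : 0 < c -> 0 < C -> 0 < delta -> 0 < t0 ->
  (forall t, t0 <= t -> (forall i, c <= u t i <= C) /\
      forall i j k, [set i; j; k]%SET \in T -> delta <= gap d (u t) i j k) ->
  exists y : 'I_N -> R, [/\ conformal_factor T d y, forall i, excess T d y i = 0 &
    exists D lam : R, [/\ 0 < D, 0 < lam &
      forall t i, t0 <= t -> `|u t i - y i| <= D * expR (- lam * t)]].
Proof.
move=> c0 C0 d0 t00 bounds.
have [A [lam [A0 lam0 HA]]] := excess_decay c0 d0 t00 bounds.
pose D := C * A / lam; have D0 : 0 < D by rewrite divr_gt0// mulr_gt0.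
have tL x : t0 <= x -> time_interval +oo x by move=> ?; apply/time_interval_pinfty; lra.
have deps (x : R) : is_derive x 1 (fun s : R => D * expR (- lam * s)) (- (C * A * expR (- lam * x))).
  have dl : is_derive x 1 (fun s : R => - lam * s) (- lam).
    apply: (is_derive_eq (is_deriveM (is_derive_cst (- lam) x 1) (is_derive_id _ _))).
    by rewrite /GRing.scale/= mulr0 mulr1 addr0.
  have de := @is_derive1_comp R (@expR R) (fun s => - lam * s) x _ _ (is_derive_expR _) dl.
  apply: (is_derive_eq (is_deriveM (is_derive_cst D x 1) de)).
  by rewrite /GRing.scale/= mulr0 addr0 /D; field; rewrite gt_eqF.
have speed x i : t0 <= x -> `|u x i * - excess T d (u x) i| <= C * A * expR (- lam * x).
  move=> t0x; have [b _] := bounds x t0x; have /andP[cu uC] := b i.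
  rewrite normrM normrN -mulrA; apply: ler_pM => //; last exact: HA.
  by rewrite ger0_norm//; lra.
have mono_up s t i : t0 <= s -> s <= t ->
    u t i + D * expR (- lam * t) <= u s i + D * expR (- lam * s).
  move=> t0s st.
  apply: (@derive_le0_nonincr R (fun x => u x i + D * expR (- lam * x))
    (fun x => u x i * - excess T d (u x) i + - (C * A * expR (- lam * x)))) => // x /andP[sx _].
    have t0x : t0 <= x by lra.
    exact: (is_deriveD (flow_derive hu i (lt_le_trans t00 t0x) (tL _ t0x)) (deps x)).
  by have := speed x i (le_trans t0s sx); rewrite ler_norml => /andP[]; lra.
have mono_dn s t i : t0 <= s -> s <= t ->
    - u t i + D * expR (- lam * t) <= - u s i + D * expR (- lam * s).
  move=> t0s st.
  apply: (@derive_le0_nonincr R (fun x => - u x i + D * expR (- lam * x))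
    (fun x => - (u x i * - excess T d (u x) i) + - (C * A * expR (- lam * x)))) => // x /andP[sx _].
    have t0x : t0 <= x by lra.
    exact: (is_deriveD (is_deriveN (flow_derive hu i (lt_le_trans t00 t0x) (tL _ t0x))) (deps x)).
  by have := speed x i (le_trans t0s sx); rewrite ler_norml => /andP[]; lra.
have eps0 t : 0 <= D * expR (- lam * t) by rewrite mulr_ge0 ?expR_ge0// ltW.
have [y Hy] : exists y : 'I_N -> R, forall i t, t0 <= t -> `|u t i - y i| <= D * expR (- lam * t).
  have H i : exists m, forall t, [set t | t0 <= t] t -> `|u t i - m| <= D * expR (- lam * t).
    apply: (@exists_limit_within R R [set t | t0 <= t] (u ^~ i) (fun t => D * expR (- lam * t))).
      by exists t0 => /=.
    move=> s t /= t0s t0t; have := eps0 s; have := eps0 t; have [st|/ltW ts] := leP s t.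
      by have := mono_up s t i t0s st; lra.
    by have := mono_dn t s i t0t ts; lra.
  by exists (fun i => projT1 (cid (H i))) => i t; exact: (projT2 (cid (H i)) t).
have PF := before_proper (L_gt0 hu).
have small E e : 0 < E -> 0 < e -> \forall t \near before (+oo%E : \bar R),
    t0 <= t /\ E * expR (- lam * t) <= e.
  move=> E0 e0; exists (Num.max t0 (E / e / lam)); split.
    by apply: tL; rewrite le_max lexx.
  move=> t; rewrite ge_max => /andP[t0t Et] _; split => //.
  rewrite mulNr expRN ler_pdivrMr ?expR_gt0// mulrC -ler_pdivrMr//.
  apply: le_trans (expR_ge1Dx _); rewrite ler_pdivrMr// mulrC in Et; lra.
have uy e : 0 < e -> \forall t \near before (+oo%E : \bar R), forall i, `|u t i - y i| <= e.
  move=> e0; apply: filterS (small D e D0 e0) => t [t0t De] i.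
  exact: le_trans (Hy i t t0t) De.
have hy : conformal_factor T d y.
  apply: (conformal_factor_limit hd PF c0 d0 uy).
  exists t0; split; first exact: tL.
  move=> t t0t _; have [b g] := bounds t t0t; split => // i.
  by case/andP: (b i).
exists y; split => //.
  move=> i; have Ly := lipschitz_near_excess i hy.
  have cv : excess T d (u t) i @[t --> before (+oo%E : \bar R)] --> excess T d y i.
    exact: lipschitz_near_cvg Ly uy.
  have cv0 : excess T d (u t) i @[t --> before (+oo%E : \bar R)] --> (0 : R).
    apply/cvgrPdist_le => e e0; apply: filterS (small A e A0 e0) => t [t0t Ae].
    by rewrite sub0r normrN; exact: le_trans (HA t i t0t) Ae.
  exact: cvg_unique cv cv0.
by exists D, lam; split => // t i; exact: Hy.
Qed.

(** Complements the decay estimates, which hold only from some time [t0] on; at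
    time 0 the flow is differentiable on one side only. *)
Lemma flow_bounded_initially (t0 : R) : 0 < t0 ->
  exists B : R, forall t i, 0 <= t <= t0 -> u t i <= B.
Proof.
move=> t00.
have H i : exists B : R, forall t, 0 <= t <= t0 -> u t i <= B.
  have [||m _ Hm] := @EVT_max R (u ^~ i) 0 t0.
  - exact: ltW.
  - apply/(continuous_within_itvP _ t00); split.
    + move=> x; rewrite in_itv/= => /andP[x0 _].
      by apply: (is_derive_continuous (flow_derive hu i x0 _)); apply/time_interval_pinfty/ltW.
    + case: hu => L0 _ _ /(_ 0 i) H; apply: (derive_within0_cvg L0 (H _)).
      exact/time_interval_pinfty.
    + have dt0 := flow_derive hu i t00 (_ : time_interval +oo t0).
      have /is_derive_continuous ct0 := dt0 (proj2 (time_interval_pinfty t0) (ltW t00)).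
      exact: cvg_at_left_filter.
  by exists (u m i) => t tt; apply: Hm; rewrite in_itv.
exists (\sum_i `|projT1 (cid (H i))|) => t i tt.
apply: le_trans (projT2 (cid (H i)) t tt) _; apply: le_trans (ler_norm _) _.
by rewrite [leRHS](bigD1 i)//= lerDl sumr_ge0.
Qed.
End Convergence.

Theorem theorem1p4 (R : realType) (N : nat) (T : {set {set 'I_N}})
    (hT : closed_surface_triangulation T)
    (d : {set 'I_N} -> R) (hd : PL_metric T d)
    (L0 : \bar R) (u : R -> 'I_N -> R)
    (hu : maximal_yamabe_solution T d L0 u)
    (hsing : forall L : \bar R, (0 < L)%E -> (L <= L0)%E ->
       ~ essential_singularity u L /\ ~ removable_singularity T d u L) :
  L0 = +oo%E /\
  exists ubar : 'I_N -> R,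
    [/\ forall i, 0 < ubar i,
        PL_metric T (conformal_mul ubar d),
        forall i j, curvature T (conformal_mul ubar d) i
                    = curvature T (conformal_mul ubar d) j
      & exists c1 c2 : R, [/\ 0 < c1, 0 < c2 &
          forall (t : R) (i : 'I_N), 0 <= t ->
            `|u t i - ubar i| <= c1 * expR (- c2 * t)]].
Proof.
case: hu => sol maxi; have L00 := L_gt0 sol.
have [noess norem] := hsing L0 L00 (lexx _).
have [c [C [delta [c0 C0 d0 bounds]]]] := bounded_of_no_singularity hT sol noess norem.
have L0E : L0 = +oo%E.
  case: L0 sol maxi L00 bounds {hsing noess norem} => [r||]// sol maxi _ bounds.
  have [h [h0 [v [vsol vu]]]] := flow_extends hd sol c0 C0 d0 bounds.
  have := maxi (r + h)%:E v _ vsol vu; rewrite lee_fin lerDl (ltW h0) => /(_ isT)[].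
  by move=> /eqP; rewrite -subr_eq0 addrC addKr gt_eqF.
subst L0; split => //.
have [t0 [t00 Ht0]] : exists t0 : R, 0 < t0 /\ forall t, t0 <= t ->
    (forall i, c <= u t i <= C) /\
    forall i j k, [set i; j; k]%SET \in T -> delta <= gap d (u t) i j k.
  have [[a [_ Ha]] [b [bL Hb]]] := (bounds, near_before_time sol).
  have b0 : 0 < b by case: (Hb b (lexx _) bL).
  exists (Num.max a b); split; first by rewrite lt_max b0 orbT.
  move=> t; rewrite ge_max => /andP[at_ bt]; apply: Ha => //.
  by apply/time_interval_pinfty; lra.
have [y [hy y0 [D [lam [D0 lam0 HD]]]]] := flow_converges hT hd sol c0 C0 d0 t00 Ht0.
exists y; split; [by case: hy|by case: hy| |].
  by move=> i j; have := y0 i; have := y0 j; rewrite /excess; lra.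
have [B HB] := flow_bounded_initially sol t00.
pose M := `|B| + \sum_i y i.
have ypos i : 0 < y i by case: hy => + _; exact.
have M0 : 0 <= M by rewrite addr_ge0// sumr_ge0// => i _; exact: ltW.
(* On [0, t0] the distance is at most M; the factor [expR (lam * t0)] absorbs the
   exponential there. *)
exists (D + M * expR (lam * t0)), lam; split => //.
  by rewrite ltr_wpDr// mulr_ge0// expR_ge0.
move=> t i t_ge0; rewrite mulrDl; have [t0t|/ltW tt0] := leP t0 t.
  apply: le_trans (HD t i t0t) _; rewrite lerDl !mulr_ge0 ?expR_ge0//.
apply: (@le_trans _ _ M); last first.
  rewrite -mulrA -expRD; apply: (@le_trans _ _ (M * 1)); first by rewrite mulr1.
  apply: ler_wpDl; first by rewrite mulr_ge0 ?expR_ge0// ltW.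
  rewrite ler_wpM2l// -expR0 ler_expR; nra.
have [ut0 _] := flow_conformal sol (proj2 (time_interval_pinfty t) t_ge0).
have uB : u t i <= B by apply: HB; rewrite t_ge0.
have yS : y i <= \sum_j y j.
  by rewrite [leRHS](bigD1 i)//= lerDl sumr_ge0// => j _; exact: ltW.
have := ut0 i; have := ypos i; have := ler_norm B.
by rewrite /M ler_norml => *; apply/andP; split; lra.
Qed.
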